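(* Let $w_0>0$. Assume that $U$ satisfies the utility assumption and that we are in the positive-wealth setting. Suppose there exist $S^*\in\mathscr S^{*}$ and, for each $t\in\{1,\ldots,T\}$, $\mathcal F_{t-1}$-measurable random variables $\beta_t>0$, $\kappa_t>0$ a.s. satisfying $$\operatorname*{ess\,inf}_{\xi\in\Xi_t^{S^*}}\mathbb P\big(\langle\xi,\Delta S^*_t\rangle\le-\beta_t\|\xi\|\,\big|\,\mathcal F_{t-1}\big)\ge\kappa_t\quad\text{a.s. on }\{D_t^{S^*}\neq\{0\}\},$$ where $\Xi_t^{S^*}=\{\xi\in L^0(\mathcal F_{t-1};\mathbb R^d):\xi\in D_t^{S^*}\text{ a.s.}\}$, such that $1/\beta_t\in\mathscr W$ for all $t$, and such that $\|\Delta S_t\|\in\mathscr W$ for all $S\in\mathscr S$ and all $t\in\{1,\ldots,T\}$. Then there exists $\hat\phi\in\mathcal A(w_0)$ such that $$u(w_0)=\inf_{S\in\mathscr S}\mathbb E_{\mathbb P}\big[U(W_T^S(w_0,\hat\phi))\big]<+\infty.$$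
   Context: Fix $d,T\in\mathbb N$ and a filtered probability space $(\Omega,\mathcal F,\mathbb F=(\mathcal F_t)_{t=0}^T,\mathbb P)$ whose $\sigma$-algebras all contain the $\mathbb P$-null sets; random variables equal a.s. are identified. For $\mathcal G\subseteq\mathcal F$, $L^0(\mathcal G;\mathbb R^n)$ is the space of $\mathcal G$-measurable $\mathbb R^n$-valued random variables with the topology of convergence in probability. Let $\mathscr S$ be a nonempty family of $\mathbb F$-adapted $\mathbb R^d$-valued processes $S=(S_t)_{t=0}^T$, and write $\Delta S_t=S_t-S_{t-1}$. Let $\mathscr L=\prod_{t=1}^T L^0(\mathcal F_{t-1};\mathbb R^d)$. For $w\in\mathbb R$, $\phi\in\mathscr L$, $S\in\mathscr S$, set $W_t^S(w,\phi)=w+\sum_{s=1}^t\langle\phi_s,\Delta S_s\rangle$. For $S\in\mathscr S$ and $t\ge1$, $D_t^S(\omega)$ is the smallest affine subspace of $\mathbb R^d$ containing the support of the regular conditional distribution of $\Delta S_t$ given $\mathcal F_{t-1}$ at $\omega$. NA($S$) means: for every $\phi\in\mathscr L$, $W_T^S(0,\phi)\ge0$ a.s. implies $W_T^S(0,\phi)=0$ a.s. $\mathscr S^{*}$ denotes the set of $S^*\in\mathscr S$ such that NA($S^*$) holds and, for every $S\in\mathscr S$ and $t$, $D_t^S\subseteq D_t^{S^*}$ a.s. $\mathscr W=\{X\in L^0(\mathcal F_T;\mathbb R):\mathbb E_{\mathbb P}[|X|^p]<\infty\text{ for all }p>0\}$. Utility assumption: $U:\mathbb R\to\mathbb R\cup\{-\infty\}$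 is non-decreasing, concave and upper semicontinuous. Positive-wealth setting: for every $S\in\mathscr S$, $\mathscr L(w_0,S)=\{\phi\in\mathscr L: W_t^S(w_0,\phi)\ge0\ \text{a.s. for all }t\in\{0,\ldots,T\}\}$, and the interior of $\{x:U(x)>-\infty\}$ is $(0,+\infty)$. Admissible set $\mathcal A(w_0)=\bigcap_{S\in\mathscr S}\mathscr L(w_0,S)$; value $u(w_0)=\sup_{\varphi\in\mathcal A(w_0)}\inf_{S\in\mathscr S}\mathbb E_{\mathbb P}[U(W_T^S(w_0,\varphi))]$, with the convention that the expectation of a random variable whose positive and negative parts both have infinite expectation is $-\infty$. *)

(* Defs.v *)
From HB Require Import structures.
From mathcomp Require Import all_boot all_order all_algebra.
From mathcomp Require Import all_classical all_reals all_analysis.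
From mathcomp Require Import measurable_realfun.
Set Implicit Arguments. Unset Strict Implicit. Unset Printing Implicit Defensive.
Import Order.TTheory GRing.Theory Num.Theory.
Import numFieldNormedType.Exports.
Local Open Scope classical_set_scope.
Local Open Scope ring_scope.

Definition vec (R : realType) (n : nat) := 'I_n -> R.
HB.instance Definition _ (R : realType) n := gen_eqMixin (vec R n).
HB.instance Definition _ (R : realType) n := gen_choiceMixin (vec R n).
HB.instance Definition _ (R : realType) n :=
  isPointed.Build (vec R n) (fun _ => 0).

Section Euclid.
Variables (R : realType) (n : nat).

Definition vzero : vec R n := fun _ => 0.
Definition vsub (x y : vec R n) : vec R n := fun i => x i - y i.
Definition vaff (x y : vec R n) (l : R) : vec R n :=
  fun i => (1 - l) * x i + l * y i.
Definition dotp (x y : vec R n) : R := \sum_(i < n) x i * y i.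
Definition enorm (x : vec R n) : R := Num.sqrt (dotp x x).
Definition eball (x : vec R n) (e : R) : set (vec R n) :=
  [set y | enorm (vsub y x) < e].
Definition eopen (O : set (vec R n)) : Prop :=
  forall x, O x -> exists2 e : R, 0 < e & eball x e `<=` O.
End Euclid.

Notation RdB R n := (g_sigma_algebraType (@eopen R n)).

Section Euclid2.
Variables (R : realType) (n : nat).
Definition msupport (mu : set (RdB R n) -> \bar R) : set (vec R n) :=
  [set x | forall e : R, 0 < e -> (0 < mu (eball x e))%E].
Definition is_affine (A : set (vec R n)) : Prop :=
  forall x y (l : R), A x -> A y -> A (vaff x y l).
Definition affhull (S : set (vec R n)) : set (vec R n) :=
  \bigcap_(A in [set A | is_affine A /\ S `<=` A]) A.
End Euclid2.

Section Prob.
Variables (R : realType) (d0 : measure_display) (Omega : measurableType d0).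
Variable (P : probability Omega R).

(* the sigma-algebra G is a sub-sigma-algebra of F containing the null sets *)
Definition Gmeas_vec n (G : set (set Omega)) (X : Omega -> vec R n) : Prop :=
  forall B : set (RdB R n), measurable B -> G (X @^-1` B).
Definition Gmeas_real (G : set (set Omega)) (X : Omega -> R) : Prop :=
  forall B : set R, measurable B -> G (X @^-1` B).
Definition Gmeas_ereal (G : set (set Omega)) (X : Omega -> \bar R) : Prop :=
  forall B : set (\bar R), measurable B -> G (X @^-1` B).

Definition is_filtration (T : nat) (F : nat -> set (set Omega)) : Prop :=
  (forall t, (t <= T)%N -> sigma_algebra setT (F t)) /\
  (forall t, (t <= T)%N -> F t `<=` measurable) /\
  (forall s t, (s <= t)%N -> (t <= T)%N -> F s `<=` F t) /\
  (forall t N A, (t <= T)%N -> measurable A -> P A = 0%E -> N `<=` A -> F t N).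

Definition complete_P : Prop :=
  forall N A, measurable A -> P A = 0%E -> N `<=` A -> measurable N.

Definition is_rcd n (G : set (set Omega)) (X : Omega -> vec R n)
    (K : Omega -> probability (RdB R n) R) : Prop :=
  (forall B : set (RdB R n), measurable B -> Gmeas_ereal G (fun w => K w B)) /\
  (forall (A : set Omega) (B : set (RdB R n)), G A -> measurable B ->
     P (A `&` X @^-1` B) = (\int[P]_(w in A) K w B)%E).

Definition Dver n (G : set (set Omega)) (X : Omega -> vec R n)
    (D : Omega -> set (vec R n)) : Prop :=
  exists K, is_rcd G X K /\ forall w, D w = affhull (msupport (K w)).

Definition is_condprob (G : set (set Omega)) (E : set Omega) (g : Omega -> R) : Prop :=
  Gmeas_real G g /\
  forall A : set Omega, G A -> P (A `&` E) = (\int[P]_(w in A) (g w)%:E)%E.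

Definition is_essinf (Fam : set (Omega -> \bar R)) (Y : Omega -> \bar R) : Prop :=
  measurable_fun setT Y /\
  (forall Z, Fam Z -> {ae P, forall w, (Y w <= Z w)%E}) /\
  (forall Y', measurable_fun setT Y' ->
     (forall Z, Fam Z -> {ae P, forall w, (Y' w <= Z w)%E}) ->
     {ae P, forall w, (Y' w <= Y w)%E}).

Definition Eexp (X : Omega -> \bar R) : \bar R :=
  let a := (\int[P]_w funepos X w)%E in
  let b := (\int[P]_w funeneg X w)%E in
  if (a == +oo)%E && (b == +oo)%E then (-oo)%E else (a - b)%E.

Definition Wspace (G : set (set Omega)) (X : Omega -> R) : Prop :=
  Gmeas_real G X /\
  forall p : R, 0 < p -> (\int[P]_w (`|X w| `^ p)%:E < +oo)%E.

Variables (n T : nat) (F : nat -> set (set Omega)).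

Definition dS (S : nat -> Omega -> vec R n) (t : nat) : Omega -> vec R n :=
  fun w => vsub (S t w) (S t.-1 w).

Definition wealth (S : nat -> Omega -> vec R n) (x : R)
    (phi : nat -> Omega -> vec R n) (t : nat) : Omega -> R :=
  fun w => x + \sum_(1 <= s < t.+1) dotp (phi s w) (dS S s w).

Definition adapted (S : nat -> Omega -> vec R n) : Prop :=
  forall t, (t <= T)%N -> Gmeas_vec (F t) (S t).

Definition predictable (phi : nat -> Omega -> vec R n) : Prop :=
  forall t, (1 <= t <= T)%N -> Gmeas_vec (F t.-1) (phi t).

Definition NA (S : nat -> Omega -> vec R n) : Prop :=
  forall phi, predictable phi ->
    {ae P, forall w, 0 <= wealth S 0 phi T w} ->
    {ae P, forall w, wealth S 0 phi T w = 0}.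

Variable Sfam : set (nat -> Omega -> vec R n).

Definition Sstar (Ss : nat -> Omega -> vec R n) : Prop :=
  Sfam Ss /\ NA Ss /\
  forall S, Sfam S -> forall t, (1 <= t <= T)%N ->
    forall D Ds, Dver (F t.-1) (dS S t) D -> Dver (F t.-1) (dS Ss t) Ds ->
      {ae P, forall w, D w `<=` Ds w}.

Definition admissible (w0 : R) (phi : nat -> Omega -> vec R n) : Prop :=
  predictable phi /\
  forall S, Sfam S -> forall t, (t <= T)%N ->
    {ae P, forall w, 0 <= wealth S w0 phi t w}.

Definition robust_util (U : R -> \bar R) (w0 : R)
    (phi : nat -> Omega -> vec R n) : \bar R :=
  ereal_inf [set Eexp (fun w => U (wealth S w0 phi T w)) | S in Sfam].

Definition value (U : R -> \bar R) (w0 : R) : \bar R :=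
  ereal_sup [set robust_util U w0 phi | phi in admissible w0].

End Prob.

Section Util.
Variable R : realType.
Definition utility_assumption (U : R -> \bar R) : Prop :=
  (forall x, U x != +oo%E) /\
  (forall x y, x <= y -> (U x <= U y)%E) /\
  (forall x y (l : R), 0 < l < 1 ->
     (l%:E * U x + (1 - l)%:E * U y <= U (l * x + (1 - l) * y)%R)%E) /\
  (forall x (a : R), (U x < a%:E)%E -> \forall y \near x, (U y < a%:E)%E).

Definition positive_wealth_U (U : R -> \bar R) : Prop :=
  interior [set x | U x != -oo%E] = [set x | 0 < x].
End Util.

(* Main.v *)
(* An admissible strategy may be projected, at each date, onto the affine hull of the
   support of the conditional law of the increment of [Ss]: that hull is a linear space
   by absence of arbitrage, and it contains the hull of every other model, so no wealth
   process changes.  After projection the quantitative no-arbitrage condition forces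
   [beta_t |phi_t| <= W_(t-1)], hence [|phi_t|] is at most a random variable having all
   moments that does not depend on the strategy.  The strategies within [1/(k+1)] of
   the value thus form a decreasing sequence of midpoint-convex sets, bounded in [L^2];
   by the parallelogram identity, near-minimisers of the [L^2]-norm over these sets
   converge almost surely along a subsequence, and Fatou's lemma applied to the
   utilities (dominated from above by an integrable variable) shows that the limit is
   optimal.

   Regular conditional distributions are obtained on the real line by feeding uniform
   noise to the conditional quantile function, and transported to [R^d] by a measurable
   injection into [0, 1] that has a measurable left inverse. *)
Require Import Defs.
From HB Require Import structures.
From mathcomp Require Import all_boot all_order all_algebra.
From mathcomp Require Import all_classical all_reals all_analysis.
From mathcomp Require Import measurable_realfun.
From mathcomp Require Import ring lra.
Import Order.TTheory GRing.Theory Num.Theory.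
Import numFieldNormedType.Exports.
Local Open Scope classical_set_scope.
Local Open Scope ring_scope.

(** * Borel structure of Euclidean space *)

(** The hypotheses see conditional supports only through [Dver], which ranges over kernels, so they
    say something only once a kernel is exhibited. As [Omega] is arbitrary, that construction works
    entirely on the side of the values. The next obstacle is that the hull depends on the scenario
    while the projection onto it must be predictable. In place of a measurable selection, a
    coordinate 1 is appended to each point: affine hulls become linear spans, the span of the
    support is that of the rows of a Gram matrix of the damped vector (1, x), these rows are
    integrals against the kernel, and Gram-Schmidt is an explicit formula in them. The same
    projection applied to the zero strategy shows that 0 lies in the hull, because its residual
    would otherwise be the gain of an arbitrage. Utilities may be -oo. Each utility X is therefore
    compared with an integrable Z above it, and only the non-negative variable max(0, Z - X) is
    integrated; convexity and Fatou are applied to that variable, and no difference of infinities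
    arises. *)

Section VecMeasurable.
Context {R : realType} {n : nat}.
Implicit Types x y z : vec R n.

Lemma dotpC x y : dotp x y = dotp y x.
Proof. by apply: eq_bigr => i _; rewrite mulrC. Qed.

Lemma dotp_ge0 x : 0 <= dotp x x.
Proof. by apply: sumr_ge0 => i _; rewrite -expr2 sqr_ge0. Qed.

Lemma dotp_eq0 x : dotp x x = 0 -> x = @vzero R n.
Proof.
move=> h; apply/funext => i; apply/eqP; rewrite -[_ == _]sqrf_eq0 expr2.
by move/eqP: h; rewrite psumr_eq0 => [|j _]; rewrite -?expr2 ?sqr_ge0// => /allP /(_ i);
  rewrite mem_index_enum => /(_ isT).
Qed.

Lemma enorm_ge0 x : 0 <= enorm x. Proof. exact: sqrtr_ge0. Qed.

Lemma enorm_sqr x : enorm x ^+ 2 = dotp x x.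
Proof. by rewrite sqr_sqrtr// dotp_ge0. Qed.

Lemma coord_le_enorm x i : `|x i| <= enorm x.
Proof.
rewrite -ler_sqr ?nnegrE ?enorm_ge0// enorm_sqr /dotp (bigD1 i)//= -normrX ger0_norm ?sqr_ge0//.
by rewrite -expr2 lerDl sumr_ge0// => j _; rewrite -expr2 sqr_ge0.
Qed.

Lemma enorm_le_sum x : enorm x <= \sum_i `|x i|.
Proof.
rewrite -ler_sqr ?nnegrE ?enorm_ge0 ?sumr_ge0// enorm_sqr expr2 mulr_suml.
apply: ler_sum => i _; rewrite -expr2 -real_normK ?num_real// expr2 ler_wpM2l//.
by rewrite (bigD1 i)//= lerDl sumr_ge0.
Qed.

Lemma dotp_cauchy x y : dotp x y ^+ 2 <= dotp x x * dotp y y.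
Proof.
have [y0|y0] := eqVneq (dotp y y) 0.
  rewrite y0 mulr0 (_ : dotp x y = 0) ?expr0n//.
  by rewrite (dotp_eq0 _ y0) /dotp big1// => i _; rewrite mulr0.
have yp : 0 < dotp y y by rewrite lt_def y0 dotp_ge0.
have sq a b : dotp (fun i => a * x i - b * y i) (fun i => a * x i - b * y i) =
    a ^+ 2 * dotp x x - 2 * (a * b) * dotp x y + b ^+ 2 * dotp y y.
  rewrite /dotp !mulr_sumr -sumrN -!big_split/=.
  by apply: eq_bigr => i _; ring.
have := dotp_ge0 (fun i => dotp y y * x i - dotp x y * y i).
rewrite sq (_ : _ + _ = dotp y y * (dotp x x * dotp y y - dotp x y ^+ 2)); last by ring.
by rewrite pmulr_rge0// subr_ge0.
Qed.

Lemma dotp_le_enorm x y : `|dotp x y| <= enorm x * enorm y.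
Proof.
rewrite -ler_sqr ?nnegrE ?mulr_ge0 ?enorm_ge0// exprMn !enorm_sqr real_normK ?num_real//.
exact: dotp_cauchy.
Qed.

Lemma enorm_triangle x y z : enorm (vsub z x) <= enorm (vsub z y) + enorm (vsub y x).
Proof.
rewrite -ler_sqr ?nnegrE ?addr_ge0 ?enorm_ge0// sqrrD !enorm_sqr.
have := dotp_le_enorm (vsub z y) (vsub y x); rewrite ler_norml => /andP[_ h].
have -> : dotp (vsub z x) (vsub z x) = dotp (vsub z y) (vsub z y) +
    dotp (vsub z y) (vsub y x) *+ 2 + dotp (vsub y x) (vsub y x).
  rewrite /dotp -sumrMnl -!big_split/=; apply: eq_bigr => i _.
  by rewrite /vsub; ring.
by rewrite lerD2r lerD2l lerMn2r.
Qed.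

Lemma eball_open x (e : R) : eopen (eball x e).
Proof.
move=> y ye; exists (e - enorm (vsub y x)); first by rewrite subr_gt0.
move=> z; rewrite /eball/= => zy.
by have := enorm_triangle x y z; lra.
Qed.

Lemma measurable_eball x (e : R) : measurable (eball x e : set (RdB R n)).
Proof. by apply: sub_sigma_algebra; exact: eball_open. Qed.

(** Open cubes with rational centres and half-sides 1/(k+1) form a countable basis of the Euclidean
    topology. Statements about all balls or all open sets are reduced to them, so that only
    countable unions and countably many null sets occur. *)
Definition rat_box (qk : {ffun 'I_n -> rat} * nat) : set (vec R n) :=
  [set y | forall i, `|y i - ratr (qk.1 i)| < qk.2.+1%:R^-1].

Lemma rat_box_in_eball x (e : R) : 0 < e ->
  exists qk, rat_box qk x /\ rat_box qk `<=` eball x e.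
Proof.
move=> e0.
have [k hk] : exists k : nat, (2 * n.+1%:R) / k.+1%:R < e.
  exists (Num.truncn ((2 * n.+1%:R) / e)).
  rewrite ltr_pdivrMr// [ltRHS]mulrC -ltr_pdivrMr//.
  exact: truncnS_gt.
have k0 : 0 < k.+1%:R^-1 :> R by rewrite invr_gt0.
have /choice[q hq] : forall i, exists q : rat, `|x i - ratr q| < k.+1%:R^-1.
  move=> i; have lt_i : x i - k.+1%:R^-1 < x i + k.+1%:R^-1 by rewrite ltrD2l gtrN.
  have [q] := rat_in_itvoo lt_i.
  rewrite in_itv/= => h; exists q.
  by rewrite ltr_norml; move: (k.+1%:R^-1) h => del h; lra.
exists ([ffun i => q i], k); split => [i|y hy]; first by rewrite ffunE.
rewrite /eball/=; apply: le_lt_trans (enorm_le_sum _) _.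
apply: le_lt_trans hk; apply: (@le_trans _ _ (\sum_(i < n) (2 / k.+1%:R : R))).
  apply: ler_sum => i _.
  have /= := hy i; rewrite ffunE => h1; have := hq i => h2.
  rewrite /vsub (_ : y i - x i = (y i - ratr (q i)) - (x i - ratr (q i))); last by ring.
  by apply: (le_trans (ler_normB _ _)); rewrite mulrDl mul1r ltW// ltrD.
rewrite sumr_const card_ord -[leLHS]mulr_natr mulrAC ler_wpM2r ?invr_ge0// ler_wpM2l//.
by rewrite ler_nat.
Qed.

Lemma open_coord_ray i (a : R) : eopen [set x : vec R n | a < x i].
Proof.
move=> x /= ax; exists (x i - a); first by rewrite subr_gt0.
move=> y; rewrite /eball/= => h.
have := le_lt_trans (coord_le_enorm _ i) h; rewrite /vsub ltr_norml; lra.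
Qed.

Lemma measurable_coord i : measurable_fun setT (fun x : RdB R n => x i).
Proof.
apply: (measurability _ (RGenOInfty.measurableE R)) => /= _ [_ [a ->] <-].
rewrite setTI; apply: sub_sigma_algebra.
rewrite (_ : _ @^-1` _ = [set x | a < x i]); first exact: open_coord_ray.
by apply/seteqP; split => x /=; rewrite in_itv/= andbT.
Qed.

(** An open set is the countable union of the rational boxes that it contains, and membership in a
    box is a finite conjunction of conditions on coordinates. *)
Lemma measurable_vec d (T : measurableType d) (f : T -> RdB R n) :
  (forall i, measurable_fun setT (fun t => f t i)) -> measurable_fun setT f.
Proof.
move=> mf; apply: (@measurability _ _ T (RdB R n) setT f (@eopen R n)) => //.
move=> _ [V oV <-]; rewrite setTI.
have -> : f @^-1` V = \bigcup_(qk in [set qk | rat_box qk `<=` V]) (f @^-1` (rat_box qk)).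
  apply/seteqP; split => t /=.
    move=> Vf; have [e e0 eV] := oV _ Vf.
    have [qk [h1 h2]] := rat_box_in_eball (f t) _ e0.
    by exists qk => //; apply: subset_trans eV.
  by move=> [qk /=]; apply.
rewrite bigcup_mkcond; apply: countable_bigcupT_measurable => // qk.
case: ifP => // _.
rewrite (_ : _ @^-1` _ = \bigcap_(i in [set: 'I_n])
   (f^~ i @^-1` [set r | `|r - ratr (qk.1 i)| < qk.2.+1%:R^-1])); last first.
  by apply/seteqP; split => t /= h i => [_|]; exact: h.
apply: fin_bigcap_measurable; first exact: finite_finset.
move=> i _; rewrite -[X in measurable X]setTI; apply: mf => //.
rewrite (_ : [set r | _] = ball (ratr (qk.1 i) : R) qk.2.+1%:R^-1); last first.
  by apply/seteqP; split => r; rewrite /ball/= distrC.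
exact: measurable_ball.
Qed.

Lemma measurable_rat_box qk : measurable (rat_box qk : set (RdB R n)).
Proof.
rewrite (_ : rat_box qk = \bigcap_(i in [set: 'I_n])
   ((fun x : RdB R n => x i) @^-1` [set r | `|r - ratr (qk.1 i)| < qk.2.+1%:R^-1])); last first.
  by apply/seteqP; split => t /= h i => [_|]; exact: h.
apply: fin_bigcap_measurable; first exact: finite_finset.
move=> i _; rewrite -[X in measurable X]setTI; apply: measurable_coord => //.
rewrite (_ : [set r | _] = ball (ratr (qk.1 i) : R) qk.2.+1%:R^-1); last first.
  by apply/seteqP; split => r; rewrite /ball/= distrC.
exact: measurable_ball.
Qed.

End VecMeasurable.

Section Measurability.
Context {R : realType} {d : measure_display} {T : measurableType d}.

(** On non-negative reals the inverse is the power of exponent -1, also at 0 where both are 0, so no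
    case distinction on the zero set of [f] is made. *)
Lemma measurable_inv_ge0 (f : T -> R) : (forall t, 0 <= f t) ->
  measurable_fun setT f -> measurable_fun setT (fun t => (f t)^-1).
Proof.
move=> f0 mf; rewrite (_ : (fun t => _) = (@powR R ^~ (-1)) \o f); last first.
  by apply/funext => t/=; rewrite powR_inv1.
exact: measurableT_comp (measurable_powR _) mf.
Qed.

Lemma measurable_set_ltr (f g : T -> R) :
  measurable_fun setT f -> measurable_fun setT g -> measurable [set t | f t < g t].
Proof.
by move=> mf mg; have := measurable_fun_ltr mf mg measurableT (_ : measurable [set true]);
  rewrite setTI; exact.
Qed.

Lemma measurable_dotp n (f g : T -> vec R n) :
  (forall i, measurable_fun setT (fun t => f t i)) ->
  (forall i, measurable_fun setT (fun t => g t i)) ->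
  measurable_fun setT (fun t => dotp (f t) (g t)).
Proof. by move=> mf mg; apply: measurable_sum => i; apply: measurable_funM. Qed.

Lemma measurable_enorm n (f : T -> vec R n) :
  (forall i, measurable_fun setT (fun t => f t i)) ->
  measurable_fun setT (fun t => enorm (f t)).
Proof.
move=> mf; apply: measurableT_comp; last exact: measurable_dotp.
by apply: continuous_measurable_fun; exact: sqrt_continuous.
Qed.

End Measurability.

(** * Sub-sigma-algebras as measurable types *)

Section SubSigma.
Context {R : realType} {d0 : measure_display} {Omega : measurableType d0}.
Variable G : set (set Omega).
Hypothesis sG : sigma_algebra setT G.

(** A sigma-algebra is the one it generates. Measurability with respect to [G] thus becomes
    measurability of a function on the type [g_sigma_algebraType G], to which the usual closure
    properties apply. *)
Lemma sub_sigmaE : @measurable _ (g_sigma_algebraType G) = G.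
Proof. exact: (@sigma_algebra_id _ setT G sG). Qed.

Lemma Gmeas_realE (X : Omega -> R) :
  Gmeas_real G X <-> measurable_fun setT (X : g_sigma_algebraType G -> R).
Proof.
split=> [h _ B mB|h B mB]; first by rewrite setTI sub_sigmaE; exact: h.
by have := h measurableT B mB; rewrite setTI sub_sigmaE.
Qed.

Lemma Gmeas_erealE (X : Omega -> \bar R) :
  Gmeas_ereal G X <-> measurable_fun setT (X : g_sigma_algebraType G -> \bar R).
Proof.
split=> [h _ B mB|h B mB]; first by rewrite setTI sub_sigmaE; exact: h.
by have := h measurableT B mB; rewrite setTI sub_sigmaE.
Qed.

Lemma Gmeas_vecE n (X : Omega -> vec R n) :
  Gmeas_vec G X <->
  forall i, measurable_fun setT ((fun w => X w i) : g_sigma_algebraType G -> R).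
Proof.
split=> [h i|h B mB].
  apply/Gmeas_realE => B mB; apply: (h ((fun x : RdB R n => x i) @^-1` B)).
  by rewrite -[X in measurable X]setTI; exact: measurable_coord.
have := @measurable_vec R n _ (g_sigma_algebraType G) X h measurableT B mB.
by rewrite setTI sub_sigmaE.
Qed.

Hypothesis GF : G `<=` measurable.

Lemma measurable_sub_sigma d' (Y : measurableType d') (X : Omega -> Y) :
  measurable_fun setT (X : g_sigma_algebraType G -> Y) -> measurable_fun setT X.
Proof.
by move=> h _ B mB; apply: GF; have := h measurableT B mB; rewrite sub_sigmaE.
Qed.

End SubSigma.

Section AlmostSure.
Context {R : realType} {d0 : measure_display} {Omega : measurableType d0}.
Variable P : probability Omega R.

Lemma ae_imply (A B : Omega -> Prop) : (forall w, A w -> B w) ->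
  {ae P, forall w, A w} -> {ae P, forall w, B w}.
Proof. by move=> AB; apply: filterS. Qed.

Lemma ae_imply2 (A B C : Omega -> Prop) : (forall w, A w -> B w -> C w) ->
  {ae P, forall w, A w} -> {ae P, forall w, B w} -> {ae P, forall w, C w}.
Proof. by move=> ABC; apply: filterS2. Qed.

Lemma ae_countable (I : countType) (A : I -> Omega -> Prop) :
  (forall i, {ae P, forall w, A i w}) -> {ae P, forall w, forall i, A i w}.
Proof.
move=> h; have : {ae P, forall w, forall n : nat, if unpickle n is Some i then A i w else True}.
  apply/ae_foralln => n; case: (unpickle n) => [i|]; first exact: h.
  exact/aeW.
by apply: ae_imply => w hw i; have := hw (pickle i); rewrite pickleK.
Qed.

Lemma probability_null (N : set Omega) : measurable N -> P N = 0%E ->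
  {ae P, forall w, ~ N w}.
Proof. by move=> mN PN; exists N; split => // w /=; apply: contrapT. Qed.

End AlmostSure.

(** * Regular conditional distributions *)

Section CondProb.
Context {R : realType} {d0 : measure_display} {Omega : measurableType d0}.
Variable P : probability Omega R.

(** The set where g < f belongs to [G] and is used as the test set: there f - g is positive, yet its
    integral vanishes after cancelling the finite integral of g. *)
Lemma ae_le_integral_subsets (f g : Omega -> R) (G : set (set Omega)) :
  sigma_algebra setT G -> G `<=` measurable ->
  measurable_fun setT (f : g_sigma_algebraType G -> R) ->
  measurable_fun setT (g : g_sigma_algebraType G -> R) ->
  (forall w, 0 <= f w) -> (forall w, 0 <= g w) ->
  (forall A, G A -> (\int[P]_(w in A) (g w)%:E < +oo)%E) ->
  (forall A, G A -> (\int[P]_(w in A) (f w)%:E <= \int[P]_(w in A) (g w)%:E)%E) ->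
  {ae P, forall w, f w <= g w}.
Proof.
move=> sG GF mf mg f0 g0 gfin fg.
have mf' := measurable_sub_sigma _ sG GF _ _ _ mf.
have mg' := measurable_sub_sigma _ sG GF _ _ _ mg.
pose B := [set w | g w < f w].
have GB : G B.
  by have := measurable_set_ltr _ _ mg mf; rewrite (sub_sigmaE _ sG).
have mB := GF _ GB.
have mh : measurable_fun B (fun w => (f w - g w)%:E).
  by apply/measurable_EFinP; apply: measurable_funB; exact: measurable_funTS.
have h0 w : B w -> (0 <= (f w - g w)%:E)%E by rewrite /B/= lee_fin subr_ge0 => /ltW.
have hD : (\int[P]_(w in B) (f w)%:E =
    \int[P]_(w in B) (f w - g w)%:E + \int[P]_(w in B) (g w)%:E)%E.
  rewrite -ge0_integralD//; last 2 first.
    by move=> w _; rewrite lee_fin.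
    by apply/measurable_EFinP; exact: measurable_funTS.
  by apply: eq_integral => w _; rewrite -EFinD subrK.
have hz : (\int[P]_(w in B) (f w - g w)%:E = 0)%E.
  apply/eqP; rewrite eq_le integral_ge0// andbT.
  have := fg _ GB; rewrite hD => le1.
  have gf : (\int[P]_(w in B) (g w)%:E)%E \is a fin_num.
    rewrite ge0_fin_numE ?gfin//; apply: integral_ge0 => w _; by rewrite lee_fin.
  by rewrite -(@leeD2rE _ (\int[P]_(w in B) (g w)%:E)%E)// add0e.
have : (\int[P]_(w in B) `|(f w - g w)%:E| = 0)%E.
  by rewrite -hz; apply: eq_integral => w; rewrite inE => Bw; rewrite gee0_abs// h0.
move=> /(ae_eq_integral_abs P mB mh); apply: filterS => w h.
rewrite leNgt; apply/negP => Bw.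
by have := h Bw => -[] /eqP; rewrite subr_eq0 => /eqP fgw; rewrite fgw ltxx in Bw.
Qed.

Section sub_measure.
Variables (G : set (set Omega)) (E : set Omega).
Hypotheses (sG : sigma_algebra setT G) (GF : G `<=` measurable) (mE : measurable E).

(** Its density with respect to the restriction of P to [G] is the conditional probability of [E].
    The hypotheses are arguments of the definition so that the instances of measure and finite
    measure can be attached to it. *)
Definition trace_measure of sigma_algebra setT G & G `<=` measurable & measurable E :=
  fun A : set (g_sigma_algebraType G) => P (A `&` E).

Local Notation nu := (trace_measure sG GF mE).

Let nu0 : nu set0 = 0%E.
Proof. by rewrite /trace_measure set0I measure0. Qed.

Let nu_ge0 A : (0 <= nu A)%E.
Proof. exact: measure_ge0. Qed.

Let nu_sigma : semi_sigma_additive nu.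
Proof.
move=> F mF tF mUF; rewrite /trace_measure setI_bigcupl.
have mF' n : measurable (F n : set Omega).
  by apply: (GF _); have := mF n; rewrite (sub_sigmaE _ sG).
apply: measure_semi_sigma_additive => //.
- by move=> n; apply: measurableI.
- by apply: trivIset_setIr.
- by apply: bigcup_measurable => n _; apply: measurableI.
Qed.

HB.instance Definition _ := isMeasure.Build _ _ _ nu nu0 nu_ge0 nu_sigma.

Let nu_fin : fin_num_fun nu.
Proof.
move=> A mA; rewrite /trace_measure fin_num_measure//; apply: measurableI => //.
by apply: (GF _); move: mA; rewrite (sub_sigmaE _ sG).
Qed.

HB.instance Definition _ := Measure_isFinite.Build _ _ _ nu nu_fin.

End sub_measure.
Arguments trace_measure {G E}.

(** Radon-Nikodym on the smaller sigma-algebra. The bounds 0 and 1 are obtained at every point, not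
    only almost surely, so that quantile functions can be built pointwise from these versions. *)
Lemma condprob_exists (G : set (set Omega)) (E : set Omega) :
  sigma_algebra setT G -> G `<=` measurable -> measurable E ->
  exists g, is_condprob P G E g /\ forall w, 0 <= g w <= 1.
Proof.
move=> sG GF mE.
pose nu : {finite_measure set (g_sigma_algebraType G) -> \bar R} := trace_measure sG GF mE.
have mid : measurable_fun setT (id : Omega -> g_sigma_algebraType G).
  by move=> _ B; rewrite (sub_sigmaE _ sG) setTI => /GF.
(* The restriction of P to [G] is realised as the law of the identity map, so integrals against it
   return to P by change of variables. *)
pose idm : {mfun Omega >-> g_sigma_algebraType G} :=
  HB.pack (id : Omega -> g_sigma_algebraType G) (isMeasurableFun.Build _ _ _ _ _ mid).
pose mu : probability (g_sigma_algebraType G) R := distribution P idm.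
have muE (A : set Omega) : mu A = P A by [].
have dom : nu `<< mu.
  apply/null_content_dominatesP => A mA muA; have PA0 : P A = 0%E by rewrite -muE.
  apply/eqP.
  rewrite eq_le measure_ge0 andbT -PA0; apply: le_measure; rewrite ?inE//.
  - by apply: measurableI => //; apply: (GF _); rewrite -(sub_sigmaE _ sG).
  - by apply: (GF _); rewrite -(sub_sigmaE _ sG).
have [f [f0 ffin fint fE]] := @radon_nikodym_sigma_finite _ _ _ mu nu dom.
have mf : measurable_fun setT f := measurable_int _ fint.
pose g := fun w => fine (f w).
have gE w : (g w)%:E = f w by rewrite fineK.
have mg : measurable_fun setT (g : g_sigma_algebraType G -> R).
  exact: measurableT_comp (@fine_measurable R setT measurableT) mf.
have g0 w : 0 <= g w by rewrite fine_ge0.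
have intE A : G A -> (P (A `&` E) = \int[P]_(w in A) (g w)%:E)%E.
  move=> GA; have := fE A; rewrite (sub_sigmaE _ sG) => /(_ GA).
  rewrite /nu/= /trace_measure => ->.
  rewrite /mu /distribution ge0_integral_pushforward//.
  - by apply: eq_integral => w _ /=.
  - by rewrite (sub_sigmaE _ sG).
  - exact: measurable_funTS.
have i1 A : G A -> (\int[P]_(w in A) (cst 1 w)%:E = P A)%E.
  by move=> /GF mA; have := integral_cst P mA 1%:E; rewrite mul1e.
have g1 : {ae P, forall w, g w <= 1}.
  apply: (@ae_le_integral_subsets g (cst 1) G) => //.
  - by move=> A GA; rewrite i1// -ge0_fin_numE ?fin_num_measure//; exact: (GF _).
  - move=> A GA; rewrite -intE// i1//.
    by apply: le_measure; rewrite ?inE//; [apply: measurableI => //|]; exact: (GF _).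
(* The density is at most 1 only almost everywhere; cutting it at 1 changes no integral and makes
   the bound hold everywhere. *)
exists (fun w => Num.min (g w) 1); split; last first.
  by move=> w; rewrite le_min g0 ler01/= ge_min lexx orbT.
have mm : measurable_fun setT ((fun w => Num.min (g w) 1) : g_sigma_algebraType G -> R).
  exact: measurable_minr.
split; first exact/(Gmeas_realE _ sG).
move=> A GA; rewrite intE//; apply: ge0_ae_eq_integral.
- exact: (GF _).
- apply/measurable_EFinP/measurable_funTS; exact: measurable_sub_sigma mg.
- apply/measurable_EFinP/measurable_funTS; exact: measurable_sub_sigma mm.
- by move=> w _; rewrite lee_fin.
- by move=> w _; rewrite lee_fin le_min g0 ler01.
- by apply: ae_imply g1 => w gw _; rewrite min_l.
Qed.

End CondProb.

(** * Quantile functions driven by uniform noise *)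

Section Quantile.
Context {R : realType}.
Implicit Types (c : rat -> R) (u x : R).

(** Generalised inverse of a distribution function on [0, 1] known at rational points only. The
    candidate 1 is always allowed, so the infimum is over a nonempty set bounded below by 0. Any
    values of [c] in [0, 1], monotone or not, give a genuine law, hence no exceptional scenarios
    have to be removed. *)
Definition quantile c u : R :=
  inf [set ratr q | q in [set q : rat | 0 <= q <= 1 /\ (q = 1 \/ u <= c q)]].

Lemma quantile_lt c u x : quantile c u < x <->
  exists q : rat, [/\ 0 <= q <= 1, q = 1 \/ u <= c q & ratr q < x].
Proof.
split.
  move=> /inf_lt[]; first by exists (ratr 1), 1 => //=; split; [|left].
  by move=> _ [q [q01 qc] <-] qx; exists q.
move=> [q [q01 qc qx]]; apply: le_lt_trans qx; apply: ge_inf; last by exists q.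
by exists 0 => _ [r [/andP[r0 _] _] <-]; rewrite ler0q.
Qed.

Lemma quantile_ltE c x : quantile c @^-1` `]-oo, x[ =
  \bigcup_(q in [set q : rat | (0 <= q <= 1) && (ratr q < x)])
    [set u | q = 1 \/ u <= c q].
Proof.
apply/seteqP; split => u /=; rewrite in_itv/= quantile_lt.
  by move=> [q [? ? ?]]; exists q => //=; apply/andP.
by move=> [q /= /andP[? ?] ?]; exists q.
Qed.

Lemma measurable_quantile c : measurable_fun setT (quantile c).
Proof.
apply: (measurability _ (RGenInftyO.measurableE R)) => /= _ [_ [x ->] <-].
rewrite setTI quantile_ltE bigcup_mkcond; apply: bigcupT_measurable_rat => q.
case: ifP => // _; have [->|/eqP q1] := eqVneq q 1.
  by rewrite (_ : [set u | _] = setT)//; apply/seteqP; split => // u _; left.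
rewrite (_ : [set u | _] = `]-oo, c q]%classic)//.
by apply/seteqP; split => u /=; rewrite in_itv/=; [case|right].
Qed.

(* Truncated at [0] so that the supremum over an empty set of rationals is [0]. *)
Definition cdf_seq c x (k : nat) : R :=
  if (unpickle k : option rat) is Some q then if (0 <= q <= 1) && (ratr q < x) then c q else 0 else 0.

(** While [c q] stands for the conditional probability of Z <= q, the supremum over rationals below
    x stands for that of the strict event Z < x. *)
Definition cdf_left c x : R := sups (cdf_seq c x) 0.

Lemma sdrop0 (v : nat -> R) : sdrop v 0 = range v.
Proof. by apply/seteqP; split => _ [k _ <-]; exists k. Qed.

Section bounded.
Variable c : rat -> R.
Hypothesis c01 : forall q, 0 <= c q <= 1.

Lemma cdf_seq01 x k : 0 <= cdf_seq c x k <= 1.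
Proof. by rewrite /cdf_seq; case: unpickle => [q|]; [case: ifP|]; rewrite ?lexx ?ler01. Qed.

Lemma has_ubound_cdf_seq x : has_ubound (range (cdf_seq c x)).
Proof. by exists 1 => _ [k _ <-]; case/andP: (cdf_seq01 x k). Qed.

Lemma cdf_left_ub x (q : rat) : 0 <= q <= 1 -> ratr q < x -> c q <= cdf_left c x.
Proof.
move=> q01 qx; apply: ub_le_sup; first by rewrite sdrop0; exact: has_ubound_cdf_seq.
by exists (pickle q) => //; rewrite /cdf_seq pickleK q01 qx.
Qed.

Lemma cdf_left_ge0 x : 0 <= cdf_left c x.
Proof.
apply: (@le_trans _ _ (cdf_seq c x 0)); first by case/andP: (cdf_seq01 x 0).
by apply: ub_le_sup; [rewrite sdrop0; exact: has_ubound_cdf_seq|exists 0%N].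
Qed.

Lemma cdf_left_le x a : 0 <= a ->
  (forall q : rat, 0 <= q <= 1 -> ratr q < x -> c q <= a) -> cdf_left c x <= a.
Proof.
move=> a0 h; apply: ge_sup; first by exists (cdf_seq c x 0), 0%N.
move=> _ [k _ <-]; rewrite /cdf_seq; case: unpickle => // q.
by case: ifP => // /andP[]; exact: h.
Qed.

Lemma cdf_left_le1 x : cdf_left c x <= 1.
Proof. by apply: cdf_left_le => // q _ _; case/andP: (c01 q). Qed.

Lemma lt_cdf_left x a : 0 <= a < cdf_left c x ->
  exists q : rat, [/\ 0 <= q <= 1, ratr q < x & a < c q].
Proof.
move=> /andP[a0 /sup_gt[]]; first by exists (cdf_seq c x 0), 0%N.
move=> _ [k _ <-]; rewrite /cdf_seq; case: unpickle => [q|]; last by move=> /lt_geF; rewrite a0.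
by case: ifP => [/andP[? ?] ?|_ /lt_geF]; [exists q|rewrite a0].
Qed.

End bounded.

(** The set is known only up to the endpoint s, since the supremum defining s may or may not be
    attained; the endpoint has Lebesgue measure 0. *)
Lemma uniform_prob_initial (E : set R) s : measurable E -> 0 <= s <= 1 ->
  `[0, s[ `<=` E -> E `&` `[0, 1] `<=` `[0, s] ->
  uniform_prob (@ltr01 R) E = s%:E.
Proof.
move=> mE /andP[s0 s1] sE Es.
have mEI : measurable (E `&` `[0, 1]) by exact: measurableI.
rewrite /uniform_prob integral_uniform_pdf.
rewrite (eq_integral (fun=> 1%:E)); last first.
  by move=> u; rewrite inE => -[_ /=]; rewrite in_itv/= /uniform_pdf => ->; rewrite subr0 invr1.
rewrite integral_cst// mul1e; apply/eqP; rewrite eq_le; apply/andP; split.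
  apply: (@le_trans _ _ (lebesgue_measure (`[0, s]%classic : set R))).
    by apply: le_measure; rewrite ?inE.
  rewrite lebesgue_measure_itv/= lte_fin; case: ifP => _; last by rewrite lee_fin.
  by rewrite sube0.
apply: (@le_trans _ _ (lebesgue_measure (`[0, s[%classic : set R))).
  rewrite lebesgue_measure_itv/= lte_fin; case: ltP => [_|s0']; first by rewrite sube0.
  by rewrite lee_fin.
apply: le_measure; rewrite ?inE// => u /[dup] us /sE Eu; split => //=.
by move: us => /=; rewrite !in_itv/= => /andP[-> /ltW us]; exact: le_trans s1.
Qed.

(** The quantile falls below x exactly when the noise is at most some [c q] with q < x, so the event
    is an initial interval of [0, 1] ending at the supremum. The bound on x excludes the default
    candidate 1. *)
Lemma quantile_cdf c x : (forall q, 0 <= c q <= 1) -> x <= 1 ->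
  uniform_prob (@ltr01 R) (quantile c @^-1` `]-oo, x[) = (cdf_left c x)%:E.
Proof.
move=> c01 x1; apply: uniform_prob_initial.
- by rewrite -[X in measurable X]setTI; apply: measurable_quantile.
- by rewrite cdf_left_ge0// cdf_left_le1.
- move=> u /=; rewrite !in_itv/= => /lt_cdf_left[q [q01 qx uq]].
  by apply/quantile_lt; exists q; split => //; right; exact: ltW.
- move=> u [/=]; rewrite !in_itv/= => /quantile_lt[q [q01 + qx]] /andP[-> _].
  case=> [q1|uq]; first by move: qx; rewrite q1 rmorph1 ltNge x1.
  exact: le_trans uq (cdf_left_ub _ c01 _ _ _ _).
Qed.

Lemma quantile_cdf1 c x : 1 < x ->
  uniform_prob (@ltr01 R) (quantile c @^-1` `]-oo, x[) = 1%E.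
Proof.
move=> x1; rewrite (_ : _ @^-1` _ = setT) ?probability_setT//.
apply/seteqP; split => // u _ /=; rewrite in_itv/=; apply/quantile_lt.
by exists 1; split => //; [left|rewrite rmorph1].
Qed.

End Quantile.

(** * Conditional law of a variable with values in [0, 1] *)

Section RealRcd.
Context {R : realType} {d0 : measure_display} {Omega : measurableType d0}.
Variables (P : probability Omega R) (G : set (set Omega)) (Z : Omega -> R).
Hypotheses (sG : sigma_algebra setT G) (GF : G `<=` measurable).
Hypotheses (mZ : measurable_fun setT Z) (Z01 : forall w, 0 <= Z w <= 1).

Local Notation unif := (uniform_prob (@ltr01 R)).

Lemma real_rcd_exists : exists c : Omega -> rat -> R,
  forall B : set R, measurable B ->
    measurable_fun setT
      ((fun w => unif (quantile (c w) @^-1` B)) : g_sigma_algebraType G -> \bar R) /\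
    forall A, G A -> (P (A `&` Z @^-1` B) = \int[P]_(w in A) unif (quantile (c w) @^-1` B))%E.
Proof.
have mE (q : R) : measurable [set w | Z w <= q].
  rewrite (_ : [set w | _] = setT `&` Z @^-1` `]-oo, q]); first exact: mZ.
  by apply/seteqP; split => w /=; rewrite in_itv/=; [|case].
have mE' (q : R) : measurable [set w | Z w < q].
  rewrite (_ : [set w | _] = setT `&` Z @^-1` `]-oo, q[); first exact: mZ.
  by apply/seteqP; split => w /=; rewrite in_itv/=; [|case].
have /choice[c0 hc0] : forall q : rat, exists g,
    is_condprob P G [set w | Z w <= ratr q] g /\ forall w, 0 <= g w <= 1.
  by move=> q; exact: condprob_exists.
pose c w q := c0 q w.
have c01 w q : 0 <= c w q <= 1 by exact: (hc0 q).2.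
have mc q : measurable_fun setT ((c ^~ q) : g_sigma_algebraType G -> R).
  by apply/Gmeas_realE => //; have [[]] := hc0 q.
have cE (q : rat) A : G A -> (P (A `&` [set w | (Z w <= ratr q)%R]) = \int[P]_(w in A) (c w q)%:E)%E.
  by have [[_ h] _] := hc0 q; exact: h.
have mleft x : measurable_fun setT ((fun w => cdf_left (c w) x) : g_sigma_algebraType G -> R).
  apply: (@measurable_fun_sups _ _ _ setT (fun k (w : g_sigma_algebraType G) => cdf_seq (c w) x k)).
    by move=> w _; exact: has_ubound_cdf_seq.
  move=> k; rewrite /cdf_seq; case: (unpickle k : option rat) => [q|]; last exact: measurable_cst.
  by case: ((0 <= q <= 1) && (ratr q < x)).
exists c.
suff : forall B : set R, <<s (@RGenInftyO.G R) >> B ->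
    measurable_fun setT
      ((fun w => unif (quantile (c w) @^-1` B)) : g_sigma_algebraType G -> \bar R) /\
    forall A, G A -> (P (A `&` Z @^-1` B) = \int[P]_(w in A) unif (quantile (c w) @^-1` B))%E.
  move=> h B mB; apply: h; have mB' : (@ocitv R).-sigma.-measurable B := mB.
  by rewrite RGenInftyO.measurableE in mB'.
have unifT w : unif (quantile (c w) @^-1` setT) = 1%E.
  by rewrite preimage_setT probability_setT.
have mpre w (B : set R) : measurable B -> measurable (quantile (c w) @^-1` B).
  by move=> mB; rewrite -[X in measurable X]setTI; exact: measurable_quantile.
have mpreZ (B : set R) : measurable B -> measurable (Z @^-1` B).
  by move=> mB; rewrite -[X in measurable X]setTI; exact: mZ.
(* Open left rays form a pi-system generating the Borel sets. Complements and disjoint unions pass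
   through both sides by additivity, so the content of the proof is in the rays. *)
apply: (@dynkin_induction _ _ (@RGenInftyO.G R)).
- exact: RGenInftyO.measurableE.
- move=> _ _ [x ->] [y ->]; exists (Num.min x y).
  by apply/seteqP; split => z /=; rewrite !in_itv/= lt_min => /andP.
- split=> [|A GA].
    by under eq_fun do rewrite unifT; exact: measurable_cst.
  rewrite preimage_setT setIT; under eq_integral do rewrite unifT.
  by rewrite integral_cst ?mul1e//; exact: GF.
- move=> _ [x ->]; have [x1|x1] := leP x 1; last first.
    split=> [|A GA].
      by under eq_fun do rewrite quantile_cdf1//; exact: measurable_cst.
    under eq_integral do rewrite quantile_cdf1//.
    rewrite integral_cst ?mul1e; last exact: GF.
    congr (P _); apply/seteqP; split => [w []//|w Aw]; split => //=.
    by rewrite in_itv/= (le_lt_trans _ x1)//; case/andP: (Z01 w).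
  split=> [|A GA].
    by under eq_fun do rewrite quantile_cdf//; exact/measurable_EFinP.
  under eq_integral do rewrite quantile_cdf//.
  have mA := GF _ GA.
  have mleft' : measurable_fun setT (fun w => cdf_left (c w) x).
    exact: measurable_sub_sigma (mleft x).
  have l0 w : (0 <= (cdf_left (c w) x)%:E)%E by rewrite lee_fin cdf_left_ge0.
  rewrite (_ : Z @^-1` _ = [set w | Z w < x]); last first.
    by apply/seteqP; split => w /=; rewrite in_itv.
  apply/eqP; rewrite eq_le; apply/andP; split.
    (* The strict event is the increasing limit of the events Z <= x - 1/(n+1); a rational q placed
       between x - 1/(n+1) and x bounds each of them through [c q]. *)
    pose D n := A `&` [set w | Z w <= x - n.+1%:R^-1].
    have -> : A `&` [set w | Z w < x] = \bigcup_n D n.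
      apply/seteqP; split => w.
        move=> [Aw /= Zx]; exists (Num.truncn ((x - Z w)^-1)) => //; split => //=.
        rewrite lerBrDr -lerBrDl -[leRHS]invrK lef_pV2 ?posrE ?invr_gt0 ?subr_gt0//.
        by rewrite ltW// truncnS_gt.
      by move=> [n _ [Aw /= Zx]]; split => //=; apply: le_lt_trans Zx _; rewrite gtrBl.
    have mD n : measurable (D n) by exact: measurableI.
    have Dnd : nondecreasing_seq D.
      apply/nondecreasing_seqP => n; apply/subsetPset => w [Aw /= Zw]; split => //=.
      by apply: le_trans Zw _; rewrite lerD2l lerN2 lef_pV2 ?posrE// ler_nat.
    have mUD : measurable (\bigcup_n D n) by exact: bigcupT_measurable.
    have Dcvg := @nondecreasing_cvg_mu _ _ _ P D mD mUD Dnd.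
    have /cvg_lim <-// := Dcvg.
    apply: lime_le; first by apply/cvg_ex; eexists; exact: Dcvg.
    apply: nearW => n /=.
    (* If the level is negative the event is empty because Z >= 0; otherwise the rational q found
       below lies in [0, 1], as [cdf_left] requires. *)
    have [xn0|xn0] := ltP (x - n.+1%:R^-1) 0.
      rewrite (_ : D n = set0) ?measure0; first by apply: integral_ge0.
      apply/seteqP; split => // w [_ /= Zw]; have /andP[Z0 _] := Z01 w.
      by have := le_lt_trans (le_trans Z0 Zw) xn0; rewrite ltxx.
    have xnx : x - n.+1%:R^-1 < x by rewrite gtrBl.
    have [q] := rat_in_itvoo xnx.
    rewrite in_itv/= => /andP[nq qx].
    have q01 : 0 <= q <= 1.
      apply/andP; split; first by rewrite -(ler0q R) (le_trans xn0 (ltW nq)).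
      by rewrite -(ler_rat R) rmorph1 (le_trans (ltW qx) x1).
    apply: (@le_trans _ _ (P (A `&` [set w | Z w <= ratr q]))).
      apply: le_measure; rewrite ?inE//; first exact: measurableI.
      by move=> w [Aw /= Zw]; split => //=; exact: le_trans Zw (ltW nq).
    rewrite cE//; apply: ge0_le_integral => //.
    - by move=> w _; rewrite lee_fin; case/andP: (c01 w q).
    - apply/measurable_EFinP/measurable_funTS; exact: measurable_sub_sigma (mc q).
    - exact/measurable_EFinP/measurable_funTS.
    - by move=> w _; rewrite lee_fin; exact: cdf_left_ub.
  (* For the reverse inequality, a version g of the conditional probability of Z < x dominates every
     [c q] with q < x. There are countably many q, so almost surely g dominates their supremum. *)
  have [g [[mg gE] g01]] := @condprob_exists R _ _ P G [set w | Z w < x] sG GF (mE' x).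
  have mg' : measurable_fun setT g.
    exact: (measurable_sub_sigma _ sG GF _ _ _ (proj1 (Gmeas_realE _ sG _) mg)).
  rewrite gE//; apply: ae_ge0_le_integral => //.
  - exact/measurable_EFinP/measurable_funTS.
  - by move=> w _; rewrite lee_fin; case/andP: (g01 w).
  - exact/measurable_EFinP/measurable_funTS.
  have : {ae P, forall w, forall q : rat, 0 <= q <= 1 -> ratr q < x -> c w q <= g w}.
    apply: ae_countable => q.
    have [qx|qx] := ltP (ratr q) x; last first.
      exact: aeW.
    suff : {ae P, forall w, c w q <= g w} by apply: ae_imply => w + _ _.
    apply: (@ae_le_integral_subsets _ _ _ P _ _ G) => //.
    + exact: (proj1 (Gmeas_realE _ sG _) mg).
    + by move=> w; case/andP: (c01 w q).
    + by move=> w; case/andP: (g01 w).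
    + move=> A' GA'; rewrite -gE// -ge0_fin_numE// fin_num_measure//.
      by apply: measurableI => //; exact: GF.
    + move=> A' GA'; rewrite -gE// -cE//; apply: le_measure; rewrite ?inE//.
      * by apply: measurableI => //; exact: GF.
      * by apply: measurableI => //; exact: GF.
      * by move=> w [A'w /= Zw]; split => //=; exact: le_lt_trans Zw qx.
  apply: ae_imply => w h _; rewrite lee_fin; apply: cdf_left_le => //.
  by case/andP: (g01 w).
- move=> B mB [mK KE].
  have KC w : unif (quantile (c w) @^-1` (~` B)) = (1 - unif (quantile (c w) @^-1` B))%E.
    by rewrite preimage_setC probability_setC//; exact: mpre.
  split=> [|A GA].
    under eq_fun do rewrite KC.
    by apply: emeasurable_funB => //; exact: measurable_cst.
  under eq_integral do rewrite KC.
  have mA := GF _ GA.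
  have mK' : measurable_fun A (fun w => unif (quantile (c w) @^-1` B)).
    by apply: measurable_funTS; exact: measurable_sub_sigma mK.
  have K1 w : (unif (quantile (c w) @^-1` B) <= 1)%E by apply: probability_le1; exact: mpre.
  have e1 : (P A = \int[P]_(w in A) (1 - unif (quantile (c w) @^-1` B)) +
                 \int[P]_(w in A) unif (quantile (c w) @^-1` B))%E.
    rewrite -ge0_integralD//.
    - rewrite -[LHS]mul1e -integral_cst//; apply: eq_integral => w _ /=.
      by rewrite subeK// fin_num_measure//; exact: mpre.
    - by move=> w _; rewrite subre_ge0//; exact: K1.
    - by apply: emeasurable_funB => //; exact: measurable_cst.
  have KEA := KE A GA; rewrite -KEA in e1.
  have fA : (P (A `&` Z @^-1` B))%E \is a fin_num.
    by rewrite fin_num_measure//; apply: measurableI => //; exact: mpreZ.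
  have e2 : (P A = P (A `&` Z @^-1` (~` B)) + P (A `&` Z @^-1` B))%E.
    rewrite preimage_setC -setDE addeC; have := measureDI P mA (mpreZ _ mB).
    by rewrite addeC => <-.
  by have := congr1 (fun z => (z - P (A `&` Z @^-1` B))%E) (esym (etrans (esym e1) e2)); rewrite !addeK.
- move=> F mF tF hF.
  have KU w : (unif (quantile (c w) @^-1` (\bigcup_k F k)) =
      \sum_(k <oo) unif (quantile (c w) @^-1` F k))%E.
    rewrite preimage_bigcup measure_semi_bigcup//.
    - by move=> k; exact: mpre.
    - apply/trivIsetP => i j _ _ ij; rewrite -preimage_setI.
      by move/trivIsetP : tF => /(_ _ _ _ _ ij) ->//; rewrite preimage_set0.
    - by rewrite -preimage_bigcup; apply: mpre; exact: bigcupT_measurable.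
  split=> [|A GA].
    under eq_fun do rewrite KU.
    by apply: ge0_emeasurable_sum => // k _; have [] := hF k.
  have mA := GF _ GA.
  under eq_integral do rewrite KU.
  rewrite integral_nneseries//; last first.
    by move=> k; apply: measurable_funTS; exact: (measurable_sub_sigma _ sG GF _ _ _ (hF k).1).
  rewrite preimage_bigcup setI_bigcupr measure_semi_bigcup//.
  - by apply: eq_eseriesr => k _; exact: (hF k).2.
  - by move=> k; apply: measurableI => //; exact: mpreZ.
  - apply/trivIsetP => i j _ _ ij; rewrite setIACA setIid -preimage_setI.
    by move/trivIsetP : tF => /(_ _ _ _ _ ij) ->//; rewrite preimage_set0 setI0.
  - by apply: bigcupT_measurable => k; apply: measurableI => //; exact: mpreZ.
Qed.

End RealRcd.

(** * Coding bit sequences in the Cantor set *)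

Section Cantor.
Context {R : realType}.
Implicit Types (b : nat -> bool) (z : R).

(** Ternary digits 0 and 2 are used because binary expansions are ambiguous at dyadic numbers. Here
    a code is at most 1/3 or at least 2/3 according to its first bit, so decoding is exact. *)
Definition cantor_partial b n : R := \sum_(0 <= k < n) (b k)%:R * 2 / 3 ^+ k.+1.
Definition cantor_code b : R := sups (cantor_partial b) 0.

Lemma cantor_partial_recl b n : cantor_partial b n.+1 =
  ((b 0%N)%:R * 2 + cantor_partial (b \o S) n) / 3.
Proof.
rewrite /cantor_partial big_nat_recl// expr1 mulrDl; congr (_ + _).
rewrite mulr_suml; apply: eq_bigr => k _ /=.
by rewrite [3 ^+ k.+2]exprS invfM mulrA mulrAC.
Qed.

Lemma cantor_partial_ge0 b n : 0 <= cantor_partial b n.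
Proof. by apply: sumr_ge0 => k _; rewrite !mulr_ge0// invr_ge0 exprn_ge0. Qed.

Lemma cantor_partial_le1 b n : cantor_partial b n <= 1.
Proof.
elim: n b => [|n IH] b; first by rewrite /cantor_partial big_nil.
rewrite cantor_partial_recl ler_pdivrMr//.
by have := IH (b \o S); case: (b 0%N) => /=; lra.
Qed.

Lemma has_ubound_cantor b : has_ubound (range (cantor_partial b)).
Proof. by exists 1 => _ [k _ <-]; exact: cantor_partial_le1. Qed.

Lemma cantor_code_ub b n : cantor_partial b n <= cantor_code b.
Proof.
by apply: ub_le_sup; [rewrite sdrop0; exact: has_ubound_cantor|exists n].
Qed.

Lemma cantor_code_le b a : (forall n, cantor_partial b n <= a) -> cantor_code b <= a.
Proof.
move=> h; apply: ge_sup; first by exists (cantor_partial b 0), 0%N.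
by move=> _ [k _ <-].
Qed.

Lemma cantor_code01 b : 0 <= cantor_code b <= 1.
Proof.
rewrite (le_trans (cantor_partial_ge0 b 0) (cantor_code_ub b 0))/=.
exact/cantor_code_le/cantor_partial_le1.
Qed.

Lemma cantor_code_shift b :
  cantor_code b = ((b 0%N)%:R * 2 + cantor_code (b \o S)) / 3.
Proof.
have /andP[c0 c1] := cantor_code01 (b \o S).
have b0 : 0 <= (b 0%N)%:R :> R by [].
apply/eqP; rewrite eq_le; apply/andP; split.
  apply: cantor_code_le => -[|n].
    by rewrite /cantor_partial big_nil; apply: divr_ge0 => //; lra.
  rewrite cantor_partial_recl ler_pM2r ?invr_gt0// lerD2l; exact: cantor_code_ub.
rewrite ler_pdivrMr// -lerBrDl; apply: cantor_code_le => n.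
have := cantor_code_ub b n.+1; rewrite cantor_partial_recl ler_pdivrMr//; lra.
Qed.

(** On codes this erases the leading ternary digit. The threshold 1/2 lies in the gap between 1/3
    and 2/3, and both branches are measurable on the whole line. *)
Definition cantor_step z : R := if 2^-1 < z then z * 3 - 2 else z * 3.
Definition cantor_digit z n : bool := 2^-1 < iter n cantor_step z.

Lemma cantor_head b : (2^-1 < cantor_code b) = b 0%N.
Proof.
rewrite cantor_code_shift; have := cantor_code01 (b \o S).
by case: (b 0%N) => /= h; [apply/idP; lra|apply/negbTE; rewrite -leNgt; lra].
Qed.

Lemma cantor_codeK b n : cantor_digit (cantor_code b) n = b n.
Proof.
rewrite /cantor_digit; have -> : iter n cantor_step (cantor_code b) =
    cantor_code (fun k => b (n + k)%N).
  elim: n => [//|n IH]; rewrite iterS IH /cantor_step cantor_head addn0.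
  rewrite cantor_code_shift addn0 divfK//.
  have -> : (if b n then (b n)%:R * 2 + cantor_code ((fun k => b (n + k)%N) \o S) - 2
             else (b n)%:R * 2 + cantor_code ((fun k => b (n + k)%N) \o S)) =
            cantor_code ((fun k => b (n + k)%N) \o S) :> R.
    by case: (b n); rewrite ?mul1r ?mul0r ?add0r// addrAC subrr add0r.
  by congr cantor_code; apply/funext => k /=; rewrite addnS addSn.
by rewrite cantor_head addn0.
Qed.

Lemma measurable_cantor_digit n : measurable_fun setT (cantor_digit ^~ n).
Proof.
rewrite /cantor_digit; apply: measurable_fun_ltr; first exact: measurable_cst.
elim: n => [|n IH] /=; first exact: measurable_id.
apply: measurable_fun_ifT.
- by apply: measurable_fun_ltr => //; exact: measurable_cst.
- by apply: measurable_funB => //; exact: measurable_funM.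
- exact: measurable_funM.
Qed.

Lemma measurable_cantor_code d (T : measurableType d) (b : T -> nat -> bool) :
  (forall k, measurable_fun setT (b ^~ k)) -> measurable_fun setT (cantor_code \o b).
Proof.
move=> mb; apply: (@measurable_fun_sups _ _ _ _ (fun n t => cantor_partial (b t) n)).
  by move=> t _; exact: has_ubound_cantor.
move=> n; apply: measurable_sum => k.
apply: measurable_funM => //; apply: measurable_funM => //.
rewrite (_ : (fun t => _) = fun t => if b t k then 1 else 0 :> R); last first.
  by apply/funext => t; case: (b t k).
by apply: measurable_fun_ifT.
Qed.

End Cantor.

(** * Measurable coding of vectors by reals *)

Section VecCode.
Context {R : realType} {n : nat}.

(* A vector is determined by the countably many bits [q < x i] with [q] rational. *)
Definition vec_bit (x : vec R n) (k : nat) : bool :=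
  if (unpickle k : option ('I_n * rat)) is Some (i, q) then ratr q < x i else false.

Definition vec_code (x : vec R n) : R := cantor_code (vec_bit x).

(** A coordinate is the supremum of the rationals below it. Bits that are off, or that belong to
    another coordinate, contribute -oo, which is neutral for the supremum. *)
Definition vec_decode_seq (z : R) (i : 'I_n) (k : nat) : \bar R :=
  if (unpickle k : option ('I_n * rat)) is Some (j, q) then
    if (j == i) && cantor_digit z k then (ratr q)%:E else -oo%E
  else -oo%E.

Definition vec_decode (z : R) : vec R n := fun i => fine (esups (vec_decode_seq z i) 0).

Lemma vec_codeK x : vec_decode (vec_code x) = x.
Proof.
apply/funext => i; rewrite /vec_decode (_ : esups _ _ = (x i)%:E)//.
apply/eqP; rewrite eq_le; apply/andP; split.
  apply: ge_ereal_sup => _ [k _ <-]; rewrite /vec_decode_seq /vec_code cantor_codeK /vec_bit.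
  case: (unpickle k : option ('I_n * rat)) => [[j q]|]; last exact: leNye.
  case: ifP => [/andP[/eqP -> h]|_]; last exact: leNye.
  by rewrite lee_fin ltW.
apply/lee_subgt0Pr => e e0.
have xe : x i - e < x i by rewrite gtrBl.
have [q] := rat_in_itvoo xe; rewrite in_itv/= => /andP[eq qx].
apply: (@le_trans _ _ (ratr q)%:E); first by rewrite lee_fin ltW.
apply: ereal_sup_ubound; exists (pickle (i, q)) => //.
by rewrite /vec_decode_seq /vec_code cantor_codeK /vec_bit pickleK eqxx qx.
Qed.

Lemma measurable_vec_code d (T : measurableType d) (f : T -> vec R n) :
  (forall i, measurable_fun setT (fun t => f t i)) -> measurable_fun setT (vec_code \o f).
Proof.
move=> mf; apply: (measurable_cantor_code _ _ (vec_bit \o f)) => k.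
rewrite /vec_bit/=; case: (unpickle k : option ('I_n * rat)) => [[i q]|]; last exact: measurable_cst.
by apply: measurable_fun_ltr => //; exact: measurable_cst.
Qed.

Lemma measurable_vec_decode : measurable_fun setT (vec_decode : R -> RdB R n).
Proof.
apply: measurable_vec => i.
apply: (measurableT_comp (@fine_measurable R setT measurableT)).
apply: (@measurable_fun_esups _ _ _ _ (fun k z => vec_decode_seq z i k)) => k.
rewrite /vec_decode_seq; case: (unpickle k : option ('I_n * rat)) => [[j q]|]; last exact: measurable_cst.
case: (j == i) => /=; last exact: measurable_cst.
apply: measurable_fun_ifT => //; exact: measurable_cantor_digit.
Qed.

End VecCode.

(** The kernel is the law of the decoded quantile of the coded vector. Because decoding inverts
    coding, the event that X lies in B is the event that the code lies in the decoding preimage of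
    B, to which the real case applies. *)
Lemma rcd_exists (R : realType) (d0 : measure_display) (Omega : measurableType d0)
  (P : probability Omega R) (G : set (set Omega)) n (X : Omega -> vec R n) :
  sigma_algebra setT G -> G `<=` measurable ->
  (forall i, measurable_fun setT (fun w => X w i)) ->
  exists K, is_rcd P G X K.
Proof.
move=> sG GF mX.
have [c hc] := @real_rcd_exists R _ _ P G (vec_code \o X) sG GF
  (measurable_vec_code _ _ _ mX) (fun w => cantor_code01 _).
have mQ w : @measurable_fun _ _ R (RdB R n) setT (vec_decode \o quantile (c w)).
  exact: measurableT_comp measurable_vec_decode (measurable_quantile _).
pose Q w : {mfun (measurableTypeR R) >-> RdB R n} :=
  HB.pack (vec_decode \o quantile (c w) : measurableTypeR R -> RdB R n)
    (isMeasurableFun.Build _ _ (measurableTypeR R) (RdB R n) _ (mQ w)).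
pose K w : probability (RdB R n) R := distribution (uniform_prob (@ltr01 R)) (Q w).
have mdec (B : set (RdB R n)) : measurable B -> measurable (vec_decode @^-1` B : set R).
  by move=> mB; rewrite -[X in measurable X]setTI; exact: measurable_vec_decode.
exists K; split=> [B mB|A B GA mB].
  by apply/Gmeas_erealE => //; exact: (hc _ (mdec B mB)).1.
rewrite -(hc _ (mdec B mB)).2//; congr (P (_ `&` _)).
by apply/seteqP; split => w /=; rewrite vec_codeK.
Qed.

(** * Projection onto the affine hull of the conditional support *)

Section Orthogonal.
Context {R : realType} {m : nat}.
Implicit Types (u v x y psi : vec R m) (vs : seq (vec R m)).

Lemma dotp_lin x y z (a : R) : dotp x (fun i => y i + a * z i) = dotp x y + a * dotp x z.
Proof.
by rewrite /dotp mulr_sumr -big_split; apply: eq_bigr => i _ /=; rewrite mulrDr mulrCA.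
Qed.

Lemma dotp_sub x y z : dotp x (vsub y z) = dotp x y - dotp x z.
Proof.
by rewrite /dotp -sumrB; apply: eq_bigr => i _ /=; rewrite mulrBr.
Qed.

Lemma dotp0 x : dotp x (@vzero R m) = 0.
Proof. by rewrite /dotp big1// => i _; rewrite mulr0. Qed.

(* Gram-Schmidt; a vanishing [u] is harmless since then [_ / 0 * u i = 0]. *)
Fixpoint span_proj vs x : vec R m :=
  if vs is v :: vs' then
    let u := vsub v (span_proj vs' v) in
    fun i => span_proj vs' x i + dotp x u / dotp u u * u i
  else @vzero R m.

Definition orth vs psi := forall v, List.In v vs -> dotp psi v = 0.

(** The two parts are proved together since each inductive step uses both. The second says dually
    that the projection lies in the span of [vs]: it is annihilated by everything orthogonal to
    [vs]. *)
Lemma span_proj_orth vs :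
  (forall x, orth vs (vsub x (span_proj vs x))) /\
  (forall x psi, orth vs psi -> dotp psi (span_proj vs x) = 0).
Proof.
elim: vs => [|v vs [IH1 IH2]].
  by split=> [x v []|x psi _]; rewrite dotp0.
rewrite /=; set u := vsub v (span_proj vs v).
have ou : orth vs u by exact: IH1.
have P2 x psi : orth (v :: vs) psi ->
    dotp psi (fun i => span_proj vs x i + dotp x u / dotp u u * u i) = 0.
  move=> opsi; have opsi' : orth vs psi by move=> v' hv'; apply: opsi; right.
  have psiu : dotp psi u = 0 by rewrite dotp_sub IH2// opsi ?subr0//; left.
  by rewrite dotp_lin IH2// add0r psiu mulr0.
split=> // x; set r := vsub x _.
have orr : orth vs r.
  move=> v' hv'; rewrite dotpC dotp_sub dotp_lin (dotpC v' u) (ou v' hv') mulr0 addr0.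
  by rewrite -dotp_sub dotpC IH1.
move=> v' [<-|]; last exact: orr.
(* The vectors v and u differ by a projection onto the span of the tail, to which r is already known
   to be orthogonal. *)
have -> : dotp r v = dotp r u by rewrite dotp_sub IH2// subr0.
rewrite dotpC dotp_sub dotp_lin IH2// add0r dotpC.
have [u0|u0] := eqVneq (dotp u u) 0; last by rewrite divfK// subrr.
by rewrite u0 mulr0 subr0 (dotp_eq0 _ u0) dotp0.
Qed.

(** Only sums, products and inverses of non-negative quantities occur. The rank of the family may
    jump from point to point; the inverse of 0 being 0 absorbs it. *)
Lemma measurable_span_proj d (T : measurableType d) (fs : seq (T -> vec R m)) :
  (forall f, List.In f fs -> forall i, measurable_fun setT (fun t => f t i)) ->
  forall g : T -> vec R m, (forall i, measurable_fun setT (fun t => g t i)) ->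
  forall i, measurable_fun setT (fun t => span_proj [seq f t | f <- fs] (g t) i).
Proof.
elim: fs => [|f fs IH] mvs g mx i /=; first exact: measurable_cst.
have mv := mvs f (or_introl erefl).
have IH' := IH (fun f' hf' => mvs f' (or_intror hf')).
set u := fun t => vsub (f t) (span_proj [seq f' t | f' <- fs] (f t)).
have mu j : measurable_fun setT (fun t => u t j).
  by apply: measurable_funB => //; exact: IH'.
apply: measurable_funD; first exact: IH'.
apply: measurable_funM; last exact: mu.
apply: measurable_funM; first exact: measurable_dotp.
apply: measurable_inv_ge0; first by move=> t; exact: dotp_ge0.
exact: measurable_dotp.
Qed.

Definition vrow x : 'rV[R]_m := \row_i x i.

(** Among matrices whose row space lies in V, one of maximal rank has row space V, as adding a row
    from V cannot raise the rank. A column of its cokernel that does not kill z is the separating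
    functional. *)
Lemma linear_separation (V : set (vec R m)) (z : vec R m) :
  V (@vzero R m) -> (forall (a : R) x y, V x -> V y -> V (fun i => y i + a * x i)) ->
  ~ V z -> exists b, (forall v, V v -> dotp b v = 0) /\ dotp b z <> 0.
Proof.
move=> V0 Vlin Vz.
pose good (A : 'M[R]_m) := forall r : 'rV[R]_m, V (fun i => (r *m A) 0 i).
pose p (r : nat) := `[< exists A, good A /\ \rank A = r >].
have p0 : exists r, p r.
  exists 0%N; apply/asboolP; exists 0; rewrite mxrank0; split => // r.
  by rewrite mulmx0 (_ : (fun i => _) = @vzero R m)//; apply/funext => i; rewrite mxE.
have pub r : p r -> (r <= m)%N by move=> /asboolP[A [_ <-]]; exact: rank_leq_row.
case: (ex_maxnP p0 pub) => r /asboolP[A [gA rA]] rmax.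
have Vsub v : V v -> (vrow v <= A)%MS.
  move=> Vv; have gB : good (A + vrow v)%MS.
    move=> s; have /sub_addsmxP[[s1 s2] /= ->] := submxMl s (A + vrow v)%MS.
    rewrite (_ : (fun i => _) = fun i => (s1 *m A) 0 i + s2 0 0 * v i).
      by apply: Vlin.
    by apply/funext => i; rewrite !mxE big_ord_recl big_ord0 addr0 !mxE.
  have le_r : (\rank (A + vrow v)%MS <= \rank A)%N.
    by rewrite rA; apply: rmax; apply/asboolP; exists (A + vrow v)%MS.
  have := (mxrank_leqif_sup (addsmxSl A (vrow v))).2.
  rewrite eqn_leq le_r mxrankS ?addsmxSl//= => /esym.
  by apply: submx_trans; exact: addsmxSr.
have subV v : (vrow v <= A)%MS -> V v.
  move=> /submxP[s sE]; rewrite (_ : v = fun i => (s *m A) 0 i); first exact: gA.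
  by apply/funext => i; rewrite -sE mxE.
have : ~~ (vrow z <= A)%MS by apply/negP => /subV.
rewrite submxE => /rV0Pn[j zj].
have dotE v : dotp (fun i => cokermx A i j) v = (vrow v *m cokermx A) 0 j.
  rewrite /dotp [RHS]mxE; apply: eq_bigr => i _.
  by rewrite [vrow v 0 i]mxE mulrC.
exists (fun i => cokermx A i j); split.
  by move=> v /Vsub; rewrite submxE dotE => /eqP ->; rewrite mxE.
by rewrite dotE; apply/eqP.
Qed.

Lemma affine_separation (D : set (vec R m)) z : D !=set0 -> is_affine D -> ~ D z ->
  exists (a : R) b, (forall x, D x -> a + dotp b x = 0) /\ a + dotp b z <> 0.
Proof.
move=> [p Dp] aD Dz.
have := @linear_separation [set v | D (fun i => p i + v i)] (vsub z p).
case.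
- by rewrite /= (_ : (fun i => _) = p)//; apply/funext => i; rewrite addr0.
- move=> a x y /= Dx Dy.
  (* An affine set contains the line through any two of its points: q1 is p + a x, then q2 is the
     midpoint p + (a x + y)/2, and doubling from p gives p + a x + y. *)
  pose q1 := vaff p (fun i => p i + x i) a.
  have Dq1 : D q1 by exact: aD.
  pose q2 := vaff q1 (fun i => p i + y i) (2^-1).
  have Dq2 : D q2 by exact: aD.
  rewrite (_ : (fun i => _) = vaff p q2 2); first exact: aD.
  by apply/funext => i; rewrite /vaff /q2 /q1 /vaff; field.
- move=> /=; rewrite (_ : (fun i => _) = z)//; apply/funext => i.
  by rewrite /vsub addrC subrK.
move=> b [bD bz]; exists (- dotp b p), b; split.
  move=> x Dx; have := bD (vsub x p); rewrite dotp_sub /= => h.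
  rewrite addrC; apply: h; rewrite (_ : (fun i => _) = x)//.
  by apply/funext => i; rewrite /vsub addrC subrK.
by rewrite addrC -dotp_sub.
Qed.

Lemma affhull_is_affine (S : set (vec R m)) : is_affine (affhull S).
Proof. by move=> x y l Sx Sy A [aA SA]; apply: (aA); [apply: Sx|apply: Sy]; split. Qed.

Lemma sub_affhull (S : set (vec R m)) : S `<=` affhull S.
Proof. by move=> x Sx A [_ SA]; exact: SA. Qed.

Lemma affhull_affine_eq0 (S : set (vec R m)) (a : R) b :
  (forall x, S x -> a + dotp b x = 0) -> forall x, affhull S x -> a + dotp b x = 0.
Proof.
move=> h x Sx; apply: (Sx [set x | a + dotp b x = 0]); split=> // {x Sx} x y l /= hx hy.
rewrite (_ : vaff x y l = fun i => x i + l * vsub y x i); last first.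
  by apply/funext => i; rewrite /vaff /vsub; ring.
have -> : a + dotp b (fun i => x i + l * vsub y x i) =
    (1 - l) * (a + dotp b x) + l * (a + dotp b y) by rewrite dotp_lin dotp_sub; ring.
by rewrite hx hy !mulr0 addr0.
Qed.

End Orthogonal.

(** * Recovering the span of a support from moments *)

Section SupportMoments.
Context {R : realType} {n : nat}.

(** The point (1, x): affine functions of x become linear functions of it, the coordinate [ord0] of
    the functional being the constant term. *)
Definition homog (x : vec R n) : vec R n.+1 :=
  fun j => if unlift ord0 j is Some i then x i else 1.

Lemma dotp_homog (psi : vec R n.+1) x :
  dotp psi (homog x) = psi ord0 + dotp (fun i => psi (lift ord0 i)) x.
Proof.
rewrite {1}/dotp big_ord_recl /homog unlift_none mulr1; congr (_ + _).
by apply: eq_bigr => i _; rewrite liftK.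
Qed.

(** A damping factor: it keeps every coordinate of (1, x) within [-1, 1], so that second moments
    exist under any law, and being positive it does not change which functionals vanish. *)
Definition vweight (x : vec R n) : R := (1 + \sum_i `|x i|)^-1.

Lemma vweight_gt0 x : 0 < vweight x.
Proof. by rewrite invr_gt0 ltr_wpDr// sumr_ge0. Qed.

Definition whomog (j : 'I_n.+1) (x : RdB R n) : R := vweight x * homog x j.

Lemma whomog_le1 j x : `|whomog j x| <= 1.
Proof.
rewrite normrM gtr0_norm ?vweight_gt0// mulrC ler_pdivrMr ?mul1r; last first.
  by rewrite ltr_wpDr// sumr_ge0.
rewrite /homog; case: unliftP => [i _|_]; last by rewrite normr1 lerDl sumr_ge0.
by rewrite (bigD1 i)//= addrCA lerDl addr_ge0// sumr_ge0.
Qed.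

Lemma measurable_whomog j : measurable_fun setT (whomog j).
Proof.
apply: measurable_funM.
  apply: measurable_inv_ge0; first by move=> x; rewrite addr_ge0// sumr_ge0.
  apply: measurable_funD; first exact: measurable_cst.
  apply: measurable_sum => i; apply: measurableT_comp => //; exact: measurable_coord.
by rewrite /homog; case: unlift => [i|]; [exact: measurable_coord|exact: measurable_cst].
Qed.

Section fixed_measure.
Variable mu : probability (RdB R n) R.

(** A point outside the support lies in a rational box of mass 0, and there are only countably many
    boxes. *)
Lemma ae_msupport : {ae mu, forall x, msupport mu x}.
Proof.
have : {ae mu, forall x, forall qk : {ffun 'I_n -> rat} * nat,
    mu (rat_box qk) = 0%E -> ~ rat_box qk x}.
  apply: ae_countable => qk; have [h|h] := pselect (mu (rat_box qk) = 0%E).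
    have := probability_null _ _ (measurable_rat_box qk) h.
    by apply: ae_imply => x + _.
  exact: aeW.
apply: ae_imply => x h e e0; have [qk [xb be]] := rat_box_in_eball x e e0.
rewrite lt_def measure_ge0 andbT; apply/eqP => mu0; apply: (h qk _ xb).
apply/eqP; rewrite eq_le measure_ge0 andbT -mu0; apply: le_measure => //; rewrite inE.
  exact: measurable_rat_box.
exact: measurable_eball.
Qed.

Lemma integrable_whomogM j l : mu.-integrable setT (EFin \o (fun x => whomog j x * whomog l x)).
Proof.
apply: measurable_bounded_integrable => //.
- by rewrite [ltLHS]probability_setT ltry.
- by apply: measurable_funM; exact: measurable_whomog.
exists 1; split; first exact: num_real.
move=> r r1 x _ /=; apply: le_trans (ltW r1); rewrite normrM -[leRHS]mulr1.
by apply: ler_pM; rewrite ?whomog_le1.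
Qed.

(** Row j of the Gram matrix of the damped vector (1, x). The rows span the same space as the points
    (1, x) with x in the support, and unlike these they are finitely many and depend measurably on
    the law. *)
Definition moment (j : 'I_n.+1) : vec R n.+1 :=
  fun l => Rintegral mu setT (fun x => whomog j x * whomog l x).

Lemma dotp_moment psi j : dotp psi (moment j) =
  Rintegral mu setT (fun x => whomog j x * (vweight x * dotp psi (homog x))).
Proof.
have E x : ((whomog j x * (vweight x * dotp psi (homog x)))%:E =
    \sum_l (psi l)%:E * (whomog j x * whomog l x)%:E)%E.
  under eq_bigr do rewrite -EFinM; rewrite sumEFin; congr EFin.
  by rewrite /dotp !mulr_sumr; apply: eq_bigr => l _; rewrite /whomog; ring.
rewrite /Rintegral; under eq_integral do rewrite E.
rewrite (integral_sum measurableT) => [|l]; last first.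
  by apply: (integrableZl measurableT); exact: integrable_whomogM.
rewrite -sum_fine => [|l _]; last first.
  apply: integrable_fin_num => //; apply: (integrableZl measurableT).
  exact: integrable_whomogM.
apply: eq_bigr => l _; rewrite (integralZl measurableT)//=; last exact: integrable_whomogM.
rewrite fineM//; apply: integrable_fin_num => //; exact: integrable_whomogM.
Qed.

Lemma moment_orth_support psi :
  (forall x, msupport mu x -> dotp psi (homog x) = 0) ->
  forall j, dotp psi (moment j) = 0.
Proof.
move=> h j; rewrite dotp_moment /Rintegral (_ : (\int[mu]_x _)%E = 0%E)//.
rewrite -[RHS](integral0 mu setT); apply: ae_eq_integral => //.
- apply/measurable_EFinP; apply: measurable_funM; first exact: measurable_whomog.
  rewrite (_ : (fun x => _) = (fun x => \sum_l psi l * whomog l x)).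
    by apply: measurable_sum => l; apply: measurable_funM => //; exact: measurable_whomog.
  by apply/funext => x; rewrite /dotp mulr_sumr; apply: eq_bigr => l _; rewrite /whomog; ring.
- by apply: ae_imply ae_msupport => x /h -> _; rewrite !mulr0.
Qed.

(** Combining the orthogonality relations with the weights [psi j] gives a vanishing integral of the
    squared functional, which is thus 0 almost everywhere. A nonzero value at a support point would
    persist on a ball of positive mass. *)
Lemma support_orth_moment psi : (forall j, dotp psi (moment j) = 0) ->
  forall x, msupport mu x -> dotp psi (homog x) = 0.
Proof.
move=> h x sx; apply: contrapT => psix.
pose s (y : RdB R n) := \sum_l psi l * whomog l y.
have sE y : s y = vweight y * dotp psi (homog y).
  by rewrite /s /dotp mulr_sumr; apply: eq_bigr => l _; rewrite /whomog; ring.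
have ms : measurable_fun setT s.
  by apply: measurable_sum => l; apply: measurable_funM => //; exact: measurable_whomog.
have int_s2 : (\int[mu]_y `|(s y ^+ 2)%:E| = 0)%E.
  have ints j : mu.-integrable setT (EFin \o (fun y => whomog j y * s y)).
    rewrite (_ : _ \o _ = fun y => (\sum_l (psi l)%:E * (whomog j y * whomog l y)%:E)%E); last first.
      apply/funext => y /=; rewrite mulr_sumr -sumEFin; apply: eq_bigr => l _.
      by rewrite -EFinM; congr EFin; ring.
    apply: integrable_sum => // l _; apply: (integrableZl measurableT).
    exact: integrable_whomogM.
  transitivity (\int[mu]_y (\sum_j (psi j)%:E * (whomog j y * s y)%:E))%E.
    apply: eq_integral => y _; rewrite gee0_abs ?lee_fin ?sqr_ge0//.
    under eq_bigr do rewrite -EFinM; rewrite sumEFin; congr EFin.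
    rewrite expr2 -[X in X * _]/(\sum_l psi l * whomog l y) mulr_suml.
    by apply: eq_bigr => j _; rewrite -mulrA.
  rewrite (integral_sum measurableT) => [|j]; last by apply: (integrableZl measurableT); exact: ints.
  rewrite big1// => j _; rewrite (integralZl measurableT)//=; last exact: ints.
  have := h j; rewrite dotp_moment /Rintegral => hj.
  have -> : (\int[mu]_y (whomog j y * s y)%:E = 0)%E; last by rewrite mule0.
  rewrite -[LHS]fineK; last by apply: integrable_fin_num => //; exact: ints.
  congr EFin; rewrite -[RHS]hj; congr fine; apply: eq_integral => y _.
  by rewrite sE.
have ms2 : measurable_fun setT (fun y => (s y ^+ 2)%:E).
  by apply/measurable_EFinP; exact: measurable_funX.
have ae0 : {ae mu, forall y, dotp psi (homog y) = 0}.
  have /(ae_eq_integral_abs mu measurableT ms2) := int_s2.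
  apply: ae_imply => y /(_ I) [] /eqP; rewrite sqrf_eq0 sE mulf_eq0.
  by rewrite (gt_eqF (vweight_gt0 _)) => /eqP.
pose b : vec R n := fun i => psi (lift ord0 i).
(* An affine function of slope b needs at least the distance |value| / |b| to reach 0; the added 1
   covers b = 0. *)
pose e := `|dotp psi (homog x)| / (enorm b + 1).
have b1 : 0 < enorm b + 1 by rewrite ltr_wpDl// enorm_ge0.
have e0 : 0 < e by rewrite divr_gt0// normr_gt0; exact/eqP.
have [N [mN muN sub]] := ae0.
have sub2 : eball x e `<=` N.
  move=> y ye; apply: sub => /= y0.
  have : dotp psi (homog x) = dotp b (vsub x y).
    by rewrite dotp_sub -[LHS]subr0 -{1}y0 !dotp_homog /b; ring.
  move=> hE; have := dotp_le_enorm b (vsub x y); rewrite -hE.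
  have -> : enorm (vsub x y) = enorm (vsub y x).
    by congr Num.sqrt; apply: eq_bigr => i _; rewrite /vsub; ring.
  move: ye; rewrite /eball/= /e ltr_pdivlMr// => ye.
  have := enorm_ge0 (vsub y x); have := enorm_ge0 b; nra.
have := sx e e0; rewrite ltNge => /negP; apply; rewrite -muN; apply: le_measure; rewrite ?inE//.
exact: measurable_eball.
Qed.

End fixed_measure.

(** The integrand lies in [-1, 1]. Adding 1 makes it non-negative, the case in which integration
    against a kernel preserves measurability, and the total mass 1 is subtracted afterwards. *)
Lemma measurable_moment d (T : measurableType d) (K : T -> probability (RdB R n) R) j l :
  (forall B, measurable B -> measurable_fun setT (fun t => K t B)) ->
  measurable_fun setT (fun t => moment (K t) j l).
Proof.
move=> mK.
have mp : measurable_fun setT (fun x => whomog j x * whomog l x).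
  by apply: measurable_funM; exact: measurable_whomog.
have p1 x : 0 <= whomog j x * whomog l x + 1.
  have : `|whomog j x * whomog l x| <= 1.
    by rewrite normrM -[leRHS]mulr1; apply: ler_pM; rewrite ?whomog_le1.
  by rewrite ler_norml; lra.
rewrite (_ : (fun t => _) = fun t =>
   fine (\int[K t]_x (whomog j x * whomog l x + 1)%:E)%E - 1); last first.
  apply/funext => t; have := @RintegralD _ _ _ (K t) setT _ (cst 1) measurableT
    (integrable_whomogM (K t) j l).
  rewrite /Rintegral => ->; last first.
    apply: measurable_bounded_integrable => //; last exact: bounded_cst.
    by rewrite [ltLHS]probability_setT ltry.
  have -> : (\int[K t]_x (cst 1 x)%:E = 1)%E.
    have := integral_cst (K t) measurableT 1%:E; rewrite mul1e => h; apply: (etrans h); exact: probability_setT.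
  by rewrite addrK.
apply: measurable_funB => //.
apply: (measurableT_comp (@fine_measurable R setT measurableT)).
apply: (measurable_fun_integral_kernel (l := K)) => //.
by apply/measurable_EFinP; apply: measurable_funD.
Qed.

End SupportMoments.

(** * Measurable projection and the conditional support *)

Section SupportProjection.
Context {R : realType} {d0 : measure_display} {Omega : measurableType d0} {n : nat}.
Variables (P : probability Omega R) (G : set (set Omega)).
Hypotheses (sG : sigma_algebra setT G) (GF : G `<=` measurable).
Variable K : Omega -> probability (RdB R n) R.

(** For a fixed box, the event that its conditional mass is 0 is in [G]; the defining identity of
    the kernel on that event shows that X almost surely avoids the box there. Countably many boxes
    suffice. *)
Lemma rcd_msupport (X : Omega -> vec R n) : is_rcd P G X K ->
  (forall i, measurable_fun setT (fun w => X w i)) ->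
  {ae P, forall w, msupport (K w) (X w)}.
Proof.
move=> [mK KE] mX.
have mX' : measurable_fun setT (X : Omega -> RdB R n) by exact: measurable_vec.
have : {ae P, forall w, forall qk : {ffun 'I_n -> rat} * nat,
    K w (rat_box qk) = 0%E -> ~ rat_box qk (X w)}.
  apply: ae_countable => qk.
  pose A := [set w | K w (rat_box qk) = 0%E].
  have mb : measurable (rat_box qk : set (RdB R n)) := measurable_rat_box qk.
  have GA : G A.
    by have := mK _ mb [set 0%E]; apply; exact: emeasurable_set1.
  have mAX : measurable (A `&` X @^-1` rat_box qk).
    apply: measurableI; first exact: GF.
    by rewrite -[X in measurable X]setTI; exact: mX'.
  have PA0 : P (A `&` X @^-1` rat_box qk) = 0%E.
    rewrite KE//; transitivity (\int[P]_(w in A) (cst 0%E w))%E; last exact: integral0.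
    by apply: eq_integral => w; rewrite inE.
  by apply: ae_imply (probability_null P _ mAX PA0) => w h Kw Xw; apply: h.
apply: ae_imply => w h e e0; have [qk [xb be]] := rat_box_in_eball (X w) e e0.
rewrite lt_def measure_ge0 andbT; apply/eqP => mu0; apply: (h qk _ xb).
apply/eqP; rewrite eq_le measure_ge0 andbT -mu0; apply: le_measure => //; rewrite inE.
  exact: measurable_rat_box.
exact: measurable_eball.
Qed.

Lemma in_List (I : eqType) (s : seq I) (x : I) : x \in s -> List.In x s.
Proof. by elim: s => // y s IH; rewrite in_cons => /orP[/eqP ->|/IH]; [left|right]. Qed.

(* [(1 - a, xi)] is the orthogonal projection of [(1, phi)] onto the linear span of
   [{(1, x) | x in the support of K w}]. *)
Lemma support_projection (phi : Omega -> vec R n) :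
  (forall B : set (RdB R n), measurable B -> Gmeas_ereal G (fun w => K w B)) ->
  Gmeas_vec G phi ->
  exists (a : Omega -> R) (xi : Omega -> vec R n),
    [/\ Gmeas_real G a, Gmeas_vec G xi,
      forall w x, msupport (K w) x -> a w + dotp (vsub (phi w) (xi w)) x = 0 &
      forall w (c : R) b, (forall x, msupport (K w) x -> c + dotp b x = 0) ->
        c * (1 - a w) + dotp b (xi w) = 0].
Proof.
move=> mK mphi.
pose fs : seq (Omega -> vec R n.+1) := [seq (fun w => moment (K w) j) | j <- enum 'I_n.+1].
pose Phi w := homog (phi w).
pose Xi w := span_proj [seq f w | f <- fs] (Phi w).
have inM w j : List.In (moment (K w) j) [seq f w | f <- fs].
  rewrite -map_comp /=; apply: (List.in_map (fun j => moment (K w) j)).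
  by apply: in_List; rewrite mem_enum.
have orthM w psi : (forall j, dotp psi (moment (K w) j) = 0) ->
    orth [seq f w | f <- fs] psi.
  move=> h v; rewrite -map_comp => /List.in_map_iff[j [<- _]]; exact: h.
have mXi j : measurable_fun setT ((fun w => Xi w j) : g_sigma_algebraType G -> R).
  apply: (@measurable_span_proj _ _ _ (g_sigma_algebraType G) fs) => [f|i].
    move=> /List.in_map_iff[l [<- _]] i; apply: measurable_moment => B mB.
    exact/Gmeas_erealE/mK.
  rewrite /Phi /homog; case: unlift => [k|]; last exact: measurable_cst.
  by have /(Gmeas_vecE _ sG) := mphi.
exists (fun w => 1 - Xi w ord0), (fun w i => Xi w (lift ord0 i)); split.
- by apply/Gmeas_realE => //; apply: measurable_funB.
- by apply/Gmeas_vecE => // i; exact: mXi.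
- move=> w x sx.
  (* The residual of the projection is orthogonal to all moments, hence to the support; its
     coordinate [ord0] is 1 - (1 - a) = a. *)
  have := support_orth_moment (K w) (vsub (Phi w) (Xi w)).
  move=> /(_ _ x sx); rewrite dotp_homog => <-.
    rewrite /vsub {1}/Phi /homog unlift_none; congr (_ + _).
    by apply: eq_bigr => i _; rewrite /Phi /homog liftK.
  by move=> j; apply: (span_proj_orth [seq f w | f <- fs]).1; exact: inM.
- move=> w c b h.
  pose psi : vec R n.+1 := fun j => if unlift ord0 j is Some i then b i else c.
  have psi0 : psi ord0 = c by rewrite /psi unlift_none.
  have psiS i : psi (lift ord0 i) = b i by rewrite /psi liftK.
  have opsi x : msupport (K w) x -> dotp psi (homog x) = 0.
    move=> sx; rewrite dotp_homog psi0 -(h x sx); congr (_ + _).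
    by apply: eq_bigr => i _; rewrite psiS.
  have := (span_proj_orth [seq f w | f <- fs]).2 (Phi w) psi.
  move=> /(_ (orthM _ _ (moment_orth_support _ _ opsi))) <-.
  have -> : 1 - (1 - Xi w ord0) = Xi w ord0 by ring.
  rewrite -/(Xi w) [RHS]/dotp big_ord_recl psi0; congr (_ + _).
  by apply: eq_bigr => i _; rewrite psiS.
Qed.

Lemma msupport_nonempty w : msupport (K w) !=set0.
Proof.
apply: contrapT => /nonemptyPn s0.
have [N [mN N0 sub]] := ae_msupport (K w).
have : K w setT = 0%E.
  apply/eqP; rewrite -measure_le0 -N0; apply: le_measure; rewrite ?inE//.
  by move=> x _; apply: sub => /= sx; have := (s0 : msupport (K w) = set0); rewrite predeqE => /(_ x)[/(_ sx)].
by move/eqP; rewrite [X in X == _]probability_setT onee_eq0.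
Qed.

(** A point outside the hull is separated from it by an affine function vanishing on the hull, and
    for a = 0 the hypothesis says that every such function also vanishes at xi. *)
Lemma projection_in_affhull (a : Omega -> R) (xi : Omega -> vec R n) w :
  (forall (c : R) b, (forall x, msupport (K w) x -> c + dotp b x = 0) ->
    c * (1 - a w) + dotp b (xi w) = 0) ->
  a w = 0 -> affhull (msupport (K w)) (xi w).
Proof.
move=> h a0; apply: contrapT => nD.
have [||c [b [bD bz]]] := affine_separation (affhull (msupport (K w))) (xi w) _ _ nD.
- by have [x sx] := msupport_nonempty w; exists x; exact: sub_affhull.
- exact: affhull_is_affine.
apply: bz; rewrite -[RHS](h c b).
  by rewrite a0 subr0 mulr1.
by move=> x sx; apply: bD; exact: sub_affhull.
Qed.

End SupportProjection.

(** * Projection and domination of strategies *)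

Section Market.
Context {R : realType} {d0 : measure_display} {Omega : measurableType d0}.
Context {P : probability Omega R} {n T : nat} {F : nat -> set (set Omega)}.
Hypothesis hF : is_filtration P T F.
Implicit Types S : nat -> Omega -> vec R n.

Lemma filtration_sigma t : (t <= T)%N -> sigma_algebra setT (F t).
Proof. by have [h _] := hF; exact: h. Qed.

Lemma filtration_sub t : (t <= T)%N -> F t `<=` measurable.
Proof. by have [_ [h _]] := hF; exact: h. Qed.

Lemma filtration_le s t : (s <= t)%N -> (t <= T)%N -> F s `<=` F t.
Proof. by have [_ [_ [h _]]] := hF; exact: h. Qed.

Lemma Gmeas_vec_le s t m (X : Omega -> vec R m) : (s <= t)%N -> (t <= T)%N ->
  Gmeas_vec (F s) X -> Gmeas_vec (F t) X.
Proof. by move=> st tT h B mB; apply: (filtration_le _ _ st tT); exact: h. Qed.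

Lemma Gmeas_real_measurable t (X : Omega -> R) : (t <= T)%N ->
  Gmeas_real (F t) X -> measurable_fun setT X.
Proof.
by move=> tT h _ B mB; rewrite setTI; apply: (filtration_sub _ tT); exact: h.
Qed.

Lemma Gmeas_vec_measurable t m (X : Omega -> vec R m) : (t <= T)%N ->
  Gmeas_vec (F t) X -> forall i, measurable_fun setT (fun w => X w i).
Proof.
move=> tT h i; have [h1 _] := Gmeas_vecE _ (filtration_sigma _ tT) m X.
exact: (measurable_sub_sigma _ (filtration_sigma _ tT) (filtration_sub _ tT) _ _ _ (h1 h i)).
Qed.

Lemma adapted_dS S t : adapted T F S -> (1 <= t <= T)%N -> Gmeas_vec (F t) (dS S t).
Proof.
move=> aS /andP[t0 tT]; apply/Gmeas_vecE; first exact: filtration_sigma.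
move=> i; apply: measurable_funB.
  by have /Gmeas_vecE := aS t tT; apply; exact: filtration_sigma.
have tT' : (t.-1 <= T)%N by rewrite (leq_trans (leq_pred _)).
have := Gmeas_vec_le t.-1 t n _ (leq_pred _) tT (aS _ tT').
by move=> /Gmeas_vecE; apply; exact: filtration_sigma.
Qed.

Lemma measurable_dS S t : adapted T F S -> (1 <= t <= T)%N ->
  forall i, measurable_fun setT (fun w => dS S t w i).
Proof.
move=> aS tT; have /andP[_ tT'] := tT.
exact: (Gmeas_vec_measurable _ _ _ tT' (adapted_dS _ _ aS tT)).
Qed.

Lemma wealth0 S x phi w : wealth S x phi 0 w = x.
Proof. by rewrite /wealth big_nil addr0. Qed.

Lemma wealthS S x phi t w :
  wealth S x phi t.+1 w = wealth S x phi t w + dotp (phi t.+1 w) (dS S t.+1 w).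
Proof. by rewrite /wealth big_nat_recr//= addrA. Qed.

Lemma Gmeas_wealth S x phi t : adapted T F S -> predictable T F phi -> (t <= T)%N ->
  Gmeas_real (F t) (wealth S x phi t).
Proof.
move=> aS pphi tT; have sF := filtration_sigma _ tT; apply/Gmeas_realE => //.
apply: measurable_funD; first exact: measurable_cst.
rewrite (_ : (fun w => _) = fun w => \sum_(s <- index_iota 1 t.+1)
  (if (1 <= s <= t)%N then dotp (phi s w) (dS S s w) else 0)); last first.
  apply/funext => w; rewrite big_nat_cond [RHS]big_nat_cond; apply: eq_bigr => s.
  by rewrite andbT ltnS => ->.
apply: measurable_sum => s; case: (boolP (1 <= s <= t)%N) => [/andP[s1 st]|_]; last exact: measurable_cst.
have sT : (s <= T)%N := leq_trans st tT.
apply: measurable_dotp => i.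
  have ps : (1 <= s <= T)%N by rewrite s1.
  have := Gmeas_vec_le s.-1 t n _ (leq_trans (leq_pred _) st) tT (pphi s ps).
  by move=> /Gmeas_vecE; apply.
have := Gmeas_vec_le s t n _ st tT (adapted_dS S s aS _).
by rewrite s1 sT => /(_ isT) /Gmeas_vecE; apply.
Qed.

Lemma measurable_wealth S x phi t : adapted T F S -> predictable T F phi -> (t <= T)%N ->
  measurable_fun setT (wealth S x phi t).
Proof. by move=> aS pphi tT; apply: Gmeas_real_measurable (Gmeas_wealth _ _ _ _ aS pphi tT). Qed.

(** Projecting (1, 0) yields a and xi with <xi, dS> = a almost surely and a = a^2 + |xi|^2. Trading
    xi at date t alone thus gains a >= 0; absence of arbitrage forces a = 0, hence xi = 0, and then
    xi lies in the hull. *)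
Lemma NA_affhull0 S t K : adapted T F S -> NA P T F S -> (1 <= t <= T)%N ->
  is_rcd P (F t.-1) (dS S t) K ->
  {ae P, forall w, affhull (msupport (K w)) (@vzero R n)}.
Proof.
move=> aS naS tT hK; have /andP[t0 tT'] := tT.
have t1T : (t.-1 <= T)%N by rewrite (leq_trans (leq_pred _)).
have sG := filtration_sigma _ t1T; have GF := filtration_sub _ t1T.
have m0 : Gmeas_vec (F t.-1) (fun _ => @vzero R n).
  by apply/Gmeas_vecE => // i; exact: measurable_cst.
have [a [xi [ma mxi h1 h2]]] := support_projection _ sG K _ hK.1 m0.
pose phi (s : nat) : Omega -> vec R n := if s == t then xi else fun _ => @vzero R n.
have pphi : predictable T F phi.
  move=> s /andP[s0 sT]; rewrite /phi; case: eqP => [->//|_].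
  apply/Gmeas_vecE; first by apply: filtration_sigma; rewrite (leq_trans (leq_pred _)).
  by move=> i; exact: measurable_cst.
have wE w : wealth S 0 phi T w = dotp (xi w) (dS S t w).
  rewrite /wealth add0r (bigD1_seq t)/=; last 2 first.
  - by rewrite mem_index_iota t0.
  - exact: iota_uniq.
  rewrite /phi eqxx big1 ?addr0// => s /negbTE ->.
  by rewrite dotpC dotp0.
(* The functional with constant term a and slope -xi vanishes on the support, so the last property
   of the projection applies to it. *)
have aE w : a w = a w ^+ 2 + dotp (xi w) (xi w).
  have := h2 w (a w) (vsub (@vzero R n) (xi w)) (h1 w).
  by rewrite dotpC dotp_sub dotp0; move: (dotp _ _) => z; lra.
have supp := rcd_msupport _ _ GF K _ hK (measurable_dS _ _ aS tT).
have xa : {ae P, forall w, dotp (xi w) (dS S t w) = a w}.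
  apply: ae_imply supp => w /(h1 w); rewrite dotpC dotp_sub dotp0 dotpC; lra.
have := naS phi pphi.
have w0 : {ae P, forall w, 0 <= wealth S 0 phi T w}.
  apply: ae_imply xa => w; rewrite wE => ->; rewrite aE.
  by rewrite addr_ge0 ?sqr_ge0 ?dotp_ge0.
move=> /(_ w0); apply: ae_imply2 xa => w xaw; rewrite wE xaw => a0.
have xi0 : xi w = @vzero R n.
  by apply: dotp_eq0; have := aE w; rewrite a0 expr0n/= add0r.
by rewrite -xi0; apply: projection_in_affhull (h2 w) a0.
Qed.

(** The affine function a + <phi - xi, x> vanishes on the hull. Evaluated at 0, which lies in the
    hull, it gives a = 0; then xi belongs to the hull and has the same inner products as phi with
    its points. *)
Lemma projection_on_affhull t (K : Omega -> probability (RdB R n) R) (phi : Omega -> vec R n) :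
  (1 <= t <= T)%N ->
  (forall B : set (RdB R n), measurable B -> Gmeas_ereal (F t.-1) (fun w => K w B)) ->
  {ae P, forall w, affhull (msupport (K w)) (@vzero R n)} ->
  Gmeas_vec (F t.-1) phi ->
  exists xi, [/\ Gmeas_vec (F t.-1) xi,
    {ae P, forall w, affhull (msupport (K w)) (xi w)} &
    {ae P, forall w, forall x, affhull (msupport (K w)) x -> dotp (phi w) x = dotp (xi w) x}].
Proof.
move=> /andP[t0 tT] mK D0 mphi.
have t1T : (t.-1 <= T)%N by rewrite (leq_trans (leq_pred _)).
have sG := filtration_sigma _ t1T.
have [a [xi [ma mxi h1 h2]]] := support_projection _ sG K _ mK mphi.
have a0 : {ae P, forall w, a w = 0}.
  by apply: ae_imply D0 => w /(affhull_affine_eq0 _ _ _ (h1 w)); rewrite dotp0 addr0.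
exists xi; split => //.
  by apply: ae_imply a0 => w; exact: projection_in_affhull (h2 w).
apply: ae_imply a0 => w aw x /(affhull_affine_eq0 _ _ _ (h1 w)).
rewrite aw add0r dotpC dotp_sub !(dotpC x) => /eqP.
by rewrite subr_eq0 => /eqP.
Qed.

(* On [{W < beta |xi|}] the wealth would become negative with conditional
   probability at least [kappa > 0]. *)
Lemma strategy_bound S t (D : Omega -> set (vec R n)) (beta kappa : Omega -> R)
    (Y : Omega -> \bar R) (xi : Omega -> vec R n) (W : Omega -> R) :
  adapted T F S -> (1 <= t <= T)%N ->
  Gmeas_real (F t.-1) beta -> {ae P, forall w, 0 < kappa w} ->
  {ae P, forall w, 0 < beta w} ->
  is_essinf P
     [set Z | exists (xi : Omega -> vec R n) (g : Omega -> R),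
        Gmeas_vec (F t.-1) xi /\
        {ae P, forall w, D w (xi w)} /\
        is_condprob P (F t.-1)
              [set w | dotp (xi w) (dS S t w) <= - (beta w * enorm (xi w))] g /\
        Z = (fun w => (g w)%:E)] Y ->
  {ae P, forall w, D w <> [set @vzero R n] -> ((kappa w)%:E <= Y w)%E} ->
  Gmeas_vec (F t.-1) xi -> {ae P, forall w, D w (xi w)} ->
  Gmeas_real (F t.-1) W -> {ae P, forall w, 0 <= W w} ->
  {ae P, forall w, 0 <= W w + dotp (xi w) (dS S t w)} ->
  {ae P, forall w, beta w * enorm (xi w) <= W w}.
Proof.
move=> aS tT mbeta kappa0 beta0 [_ [Yle _]] kY mxi Dxi mW W0 W1.
have /andP[t0 tT'] := tT.
have t1T : (t.-1 <= T)%N by rewrite (leq_trans (leq_pred _)).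
have sG := filtration_sigma _ t1T; have GF := filtration_sub _ t1T.
have mxi' : forall i, measurable_fun setT ((fun w => xi w i) : g_sigma_algebraType (F t.-1) -> R).
  exact/Gmeas_vecE.
have mbx : measurable_fun setT
    ((fun w => beta w * enorm (xi w)) : g_sigma_algebraType (F t.-1) -> R).
  by apply: measurable_funM; [exact/Gmeas_realE|exact: measurable_enorm].
have mbx' := measurable_sub_sigma _ sG GF _ _ _ mbx.
pose E := [set w | dotp (xi w) (dS S t w) <= - (beta w * enorm (xi w))].
have mE : measurable E.
  rewrite (_ : E = ~` [set w | - (beta w * enorm (xi w)) < dotp (xi w) (dS S t w)]); last first.
    by apply/seteqP; split => w /= h; [apply/negP; rewrite -leNgt|rewrite /E/= leNgt; apply/negP].
  apply: measurableC; apply: measurable_set_ltr; first exact: measurableT_comp.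
  apply: measurable_dotp; last exact: measurable_dS.
  exact: (Gmeas_vec_measurable _ _ _ t1T).
have [g [hg g01]] := condprob_exists P (F t.-1) E sG GF mE.
pose B := [set w | W w < beta w * enorm (xi w)].
have GB : F t.-1 B.
  have mW' : measurable_fun setT (W : g_sigma_algebraType (F t.-1) -> R) by exact/Gmeas_realE.
  by have := measurable_set_ltr _ _ mW' mbx; rewrite (sub_sigmaE _ sG).
have mB := GF _ GB.
(* On both events W + <xi, dS> <= W - beta |xi| < 0, which the last hypothesis allows only on a null
   set. *)
have PBE : P (B `&` E) = 0%E.
  have [N [mN N0 sub]] := W1.
  apply/eqP; rewrite -measure_le0 -N0; apply: le_measure; rewrite ?inE//.
    exact: measurableI.
  move=> w [Bw Ew]; apply: sub => /=; apply/negP; rewrite -ltNge.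
  by move: Bw Ew; rewrite /B /E/=; lra.
have mg : measurable_fun setT g := Gmeas_real_measurable _ _ t1T hg.1.
have int0 : (\int[P]_(w in B) `|(g w)%:E| = 0)%E.
  rewrite -PBE hg.2//; apply: eq_integral => w _.
  by rewrite gee0_abs// lee_fin; case/andP: (g01 w).
have mgE : measurable_fun B (fun w => (g w)%:E) by apply/measurable_EFinP/measurable_funTS.
have /(ae_eq_integral_abs P mB mgE) g0 := int0.
have Yg : {ae P, forall w, (Y w <= (g w)%:E)%E} by apply: Yle; exists xi, g.
have kg : {ae P, forall w, D w <> [set @vzero R n] -> 0 < g w}.
  apply: ae_imply2 (ae_imply2 _ _ _ _ (fun w => @conj _ _) kappa0 kY) Yg => w [k0 kYw] Yw Dw.
  by rewrite -lte_fin (lt_le_trans _ (le_trans (kYw Dw) Yw))// lte_fin.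
have Dxg := ae_imply2 _ _ _ _ (fun w => @conj _ _) Dxi kg.
have BW := ae_imply2 _ _ _ _ (fun w => @conj _ _) W0 g0.
apply: ae_imply2 Dxg BW => w [Dw gw] [Ww Bw]; rewrite leNgt; apply/negP => hB.
(* Where the bound fails xi is nonzero, so the set D that contains it is not {0}; there g is
   positive by the essential infimum condition, against g = 0 on B. *)
have xi0 : xi w <> @vzero R n.
  move=> x0; move: hB; rewrite x0 /enorm dotp0 sqrtr0 mulr0; lra.
have : D w <> [set @vzero R n] by move=> DE; move: Dw; rewrite DE.
by move=> /gw; have := Bw hB => -[] ->; rewrite ltxx.
Qed.

End Market.

(** * A bound on strategies independent of the strategy *)

Section Domination.
Context {R : realType} {d0 : measure_display} {Omega : measurableType d0}.
Context {P : probability Omega R} {n T : nat} {F : nat -> set (set Omega)}.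
Variables (Sfam : set (nat -> Omega -> vec R n)) (w0 : R).
Variables (Ss : nat -> Omega -> vec R n) (beta kappa : nat -> Omega -> R).
Hypothesis hF : is_filtration P T F.
Hypothesis adS : forall S, Sfam S -> adapted T F S.
Hypothesis hSs : Sstar P T F Sfam Ss.
Hypothesis hbk : forall t, (1 <= t <= T)%N ->
       Gmeas_real (F t.-1) (beta t) /\ Gmeas_real (F t.-1) (kappa t) /\
       {ae P, forall w, 0 < beta t w} /\ {ae P, forall w, 0 < kappa t w} /\
       Wspace P (F T) (fun w => (beta t w)^-1) /\
       forall D, Dver P (F t.-1) (dS Ss t) D ->
             exists Y, is_essinf P
               [set Z | exists (xi : Omega -> vec R n) (g : Omega -> R),
                  Gmeas_vec (F t.-1) xi /\
                  {ae P, forall w, D w (xi w)} /\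
                  is_condprob P (F t.-1)
                        [set w | dotp (xi w) (dS Ss t w)
                                 <= - (beta t w * enorm (xi w))] g /\
                  Z = (fun w => (g w)%:E)] Y /\
             {ae P, forall w, D w <> [set @vzero R n] -> ((kappa t w)%:E <= Y w)%E}.

(** Discrete Gronwall product: |phi_s| <= W_(s-1) / beta_s gives W_s <= W_(s-1) (1 + |dS_s| /
    beta_s) under the model [Ss]. *)
Definition wealth_bound (t : nat) (w : Omega) : R :=
  w0 * \prod_(1 <= s < t.+1) (1 + enorm (dS Ss s w) * (beta s w)^-1).

Definition strategy_dom (t : nat) (w : Omega) : R := wealth_bound t.-1 w * (beta t w)^-1.

(** The last clause holds for every W because the wealth it is applied to, that of the projected
    strategy, is defined only after a projection has been chosen at each date. *)
Lemma one_step_projection t (phi : Omega -> vec R n) : (1 <= t <= T)%N ->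
  Gmeas_vec (F t.-1) phi ->
  exists xi, [/\ Gmeas_vec (F t.-1) xi,
    (forall S, Sfam S -> {ae P, forall w, dotp (phi w) (dS S t w) = dotp (xi w) (dS S t w)}) &
    (forall W, Gmeas_real (F t.-1) W -> {ae P, forall w, 0 <= W w} ->
      {ae P, forall w, 0 <= W w + dotp (xi w) (dS Ss t w)} ->
      {ae P, forall w, beta t w * enorm (xi w) <= W w})].
Proof.
move=> tT mphi; have /andP[t0 tT'] := tT.
have t1T : (t.-1 <= T)%N by rewrite (leq_trans (leq_pred _)).
have sG := filtration_sigma hF _ t1T; have GF := filtration_sub hF _ t1T.
have [SsF [naSs domSs]] := hSs; have aSs := adS _ SsF.
have [K hK] := rcd_exists R _ _ P _ n _ sG GF (measurable_dS hF _ _ aSs tT).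
have D0 := NA_affhull0 hF _ _ _ aSs naSs tT hK.
have [xi [mxi Dxi xiE]] := projection_on_affhull hF _ _ _ tT hK.1 D0 mphi.
have DK : Dver P (F t.-1) (dS Ss t) (fun w => affhull (msupport (K w))) by exists K.
exists xi; split=> [//|S SF|W mW W0 W1].
  have aS := adS _ SF.
  have [K' hK'] := rcd_exists R _ _ P _ n _ sG GF (measurable_dS hF _ _ aS tT).
  have DK' : Dver P (F t.-1) (dS S t) (fun w => affhull (msupport (K' w))) by exists K'.
  have sub := domSs _ SF _ tT _ _ DK' DK.
  have supp := rcd_msupport _ _ GF K' _ hK' (measurable_dS hF _ _ aS tT).
  have insub := ae_imply2 _ _ _ _ (fun w => @conj _ _) sub supp.
  apply: ae_imply2 xiE insub => w h [subw Xw]; apply: h; apply: subw.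
  exact: sub_affhull.
have [mb [_ [b0 [k0 [_ hD]]]]] := hbk _ tT.
have [Y [hY kY]] := hD _ DK.
exact: (strategy_bound hF _ _ _ _ _ _ _ _ aSs tT mb k0 b0 hY kY mxi Dxi mW W0 W1).
Qed.

Lemma dominated_strategy phi : admissible P T F Sfam w0 phi ->
  exists phi', [/\ admissible P T F Sfam w0 phi',
    (forall S, Sfam S -> {ae P, forall w, wealth S w0 phi' T w = wealth S w0 phi T w}) &
    (forall t, (1 <= t <= T)%N -> {ae P, forall w, enorm (phi' t w) <= strategy_dom t w})].
Proof.
move=> [pphi adm].
have [SsF _] := hSs; have aSs := adS _ SsF.
have /choice[phi' hphi'] : forall t, exists xi, (1 <= t <= T)%N -> [/\ Gmeas_vec (F t.-1) xi,
    (forall S, Sfam S -> {ae P, forall w, dotp (phi t w) (dS S t w) = dotp (xi w) (dS S t w)}) &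
    (forall W, Gmeas_real (F t.-1) W -> {ae P, forall w, 0 <= W w} ->
      {ae P, forall w, 0 <= W w + dotp (xi w) (dS Ss t w)} ->
      {ae P, forall w, beta t w * enorm (xi w) <= W w})].
  move=> t; have [tT|tT] := boolP (1 <= t <= T)%N; last by exists (phi t).
  by have [xi h] := one_step_projection _ _ tT (pphi _ tT); exists xi.
have pphi' : predictable T F phi' by move=> t tT; have [] := hphi' t tT.
have wE S : Sfam S -> forall t, (t <= T)%N ->
    {ae P, forall w, wealth S w0 phi' t w = wealth S w0 phi t w}.
  move=> SF; elim=> [|t IH] tT; first by apply: aeW => w; rewrite !wealth0.
  have [_ /(_ _ SF) h _] := hphi' t.+1 tT.
  by apply: ae_imply2 h (IH (ltnW tT)) => w e1 e2; rewrite !wealthS e1 e2.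
have adm' S : Sfam S -> forall t, (t <= T)%N -> {ae P, forall w, 0 <= wealth S w0 phi' t w}.
  by move=> SF t tT; apply: ae_imply2 (adm _ SF _ tT) (wE _ SF _ tT) => w h ->.
have bphi t : (1 <= t <= T)%N ->
    {ae P, forall w, enorm (phi' t w) <= wealth Ss w0 phi' t.-1 w * (beta t w)^-1}.
  move=> tT; have [_ _ h] := hphi' t tT.
  have t1T : (t.-1 <= T)%N by case/andP: tT => _ ?; rewrite (leq_trans (leq_pred _)).
  have := h (wealth Ss w0 phi' t.-1) (Gmeas_wealth hF _ _ _ _ aSs pphi' t1T) (adm' _ SsF _ t1T).
  have [_ [_ [b0 _]]] := hbk _ tT.
  move=> /(_ _)/wrap[|hb].
    have /andP[t0 tT'] := tT; apply: ae_imply (adm' _ SsF _ tT') => w.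
    by case: t t0 {h t1T tT tT' b0} => // t _; rewrite wealthS.
  apply: ae_imply2 b0 hb => w bw hw.
  by rewrite ler_pdivlMr// mulrC.
have ub t : (t <= T)%N -> {ae P, forall w, wealth Ss w0 phi' t w <= wealth_bound t w}.
  elim: t => [|t IH] tT.
    by apply: aeW => w; rewrite wealth0 /wealth_bound big_nil mulr1.
  have [_ [_ [b0 _]]] := hbk t.+1 tT.
  have h1 := ae_imply2 _ _ _ _ (fun w => @conj _ _) (bphi t.+1 tT) (IH (ltnW tT)).
  apply: ae_imply2 h1 b0 => w /= [bw IHw] bt.
  rewrite wealthS /wealth_bound big_nat_recr//= mulrA -/(wealth_bound t w).
  have dle := le_trans (ler_norm _) (dotp_le_enorm (phi' t.+1 w) (dS Ss t.+1 w)).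
  have d0' := enorm_ge0 (dS Ss t.+1 w).
  have bi : 0 <= (beta t.+1 w)^-1 by rewrite invr_ge0 ltW.
  have c0 : 0 <= 1 + enorm (dS Ss t.+1 w) * (beta t.+1 w)^-1 by rewrite addr_ge0// mulr_ge0.
  apply: le_trans (ler_wpM2r c0 IHw).
  rewrite mulrDr mulr1 lerD2l; apply: (le_trans dle).
  by rewrite mulrA mulrAC ler_wpM2r.
exists phi'; split=> [//|S SF|t tT]; first exact: wE.
have t1T : (t.-1 <= T)%N by case/andP: tT => _ ?; rewrite (leq_trans (leq_pred _)).
have [_ [_ [b0 _]]] := hbk _ tT.
have h1 := ae_imply2 _ _ _ _ (fun w => @conj _ _) (bphi t tT) (ub _ t1T).
apply: ae_imply2 h1 b0 => w [bw uw] bt.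
by apply: (le_trans bw); rewrite /strategy_dom ler_wpM2r// invr_ge0 ltW.
Qed.

End Domination.

(** * Integrability, expectation and compactness *)

Section Moments.
Context {R : realType} {d0 : measure_display} {Omega : measurableType d0}.
Variables (P : probability Omega R) (G : set (set Omega)).
Hypotheses (sG : sigma_algebra setT G) (GF : G `<=` measurable).
Implicit Types X Y : Omega -> R.

Lemma Wspace_meas X : Wspace P G X -> measurable_fun setT (X : g_sigma_algebraType G -> R).
Proof. by move=> [mX _]; exact/Gmeas_realE. Qed.

Lemma Wspace_measurable X : Wspace P G X -> measurable_fun setT X.
Proof. by move=> /Wspace_meas; exact: (measurable_sub_sigma _ sG GF). Qed.

Lemma measurable_powR_norm X (p : R) : measurable_fun setT X ->
  measurable_fun setT (fun w => `|X w| `^ p).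
Proof.
move=> mX; apply: (measurableT_comp (measurable_powR p)).
exact: measurableT_comp.
Qed.

Lemma WspaceI X (B : R -> Omega -> R) :
  measurable_fun setT (X : g_sigma_algebraType G -> R) ->
  (forall p, 0 < p -> measurable_fun setT (B p)) ->
  (forall p w, 0 < p -> `|X w| `^ p <= B p w) ->
  (forall p, 0 < p -> (\int[P]_w (B p w)%:E < +oo)%E) -> Wspace P G X.
Proof.
move=> mX mB XB Bfin; split; first exact/Gmeas_realE.
move=> p p0; apply: le_lt_trans (Bfin p p0); apply: ge0_le_integral => //.
- apply/measurable_EFinP; apply: measurable_powR_norm.
  exact: (measurable_sub_sigma _ sG GF _ _ _ mX).
- by apply/measurable_EFinP; exact: mB.
- by move=> w _; rewrite lee_fin; exact: XB.
Qed.

Lemma Wspace_cst (c : R) : Wspace P G (fun _ => c).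
Proof.
apply: (@WspaceI _ (fun p _ => `|c| `^ p)) => // p _.
have h := integral_cst P measurableT (`|c| `^ p)%:E.
rewrite h; apply: lte_mul_pinfty; rewrite ?lee_fin ?powR_ge0//.
by rewrite -ge0_fin_numE// fin_num_measure.
Qed.

Lemma Wspace_lty X p c : Wspace P G X -> 0 < p -> 0 <= c ->
  (\int[P]_w (c * `|X w| `^ p)%:E < +oo)%E.
Proof.
move=> WX p0 c0; under eq_integral do rewrite EFinM.
rewrite ge0_integralZl_EFin//.
  by apply: lte_mul_pinfty => //; exact: WX.2.
exact/measurable_EFinP/measurable_powR_norm/Wspace_measurable.
Qed.

Lemma integralD_lty (f g : Omega -> R) : measurable_fun setT f -> measurable_fun setT g ->
  (forall w, 0 <= f w) -> (forall w, 0 <= g w) ->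
  (\int[P]_w (f w)%:E < +oo)%E -> (\int[P]_w (g w)%:E < +oo)%E ->
  (\int[P]_w (f w + g w)%:E < +oo)%E.
Proof.
move=> mf mg f0 g0 ff gf; under eq_integral do rewrite EFinD.
rewrite ge0_integralD//.
- exact: lte_add_pinfty.
- by move=> w _; rewrite lee_fin.
- exact/measurable_EFinP.
- by move=> w _; rewrite lee_fin.
- exact/measurable_EFinP.
Qed.

(** From a b <= a^2 + b^2 with a = |X|^p and b = |Y|^p. Having all moments is what makes the class
    stable under the long products of [strategy_dom]. *)
Lemma WspaceM X Y : Wspace P G X -> Wspace P G Y -> Wspace P G (fun w => X w * Y w).
Proof.
move=> WX WY.
have mX p := measurable_powR_norm _ p (Wspace_measurable _ WX).
have mY p := measurable_powR_norm _ p (Wspace_measurable _ WY).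
apply: (@WspaceI _ (fun p w => 1 * `|X w| `^ (p * 2) + 1 * `|Y w| `^ (p * 2))).
- by apply: measurable_funM; exact: Wspace_meas.
- by move=> p _; apply: measurable_funD; apply: measurable_funM.
- move=> p w p0; rewrite normrM powRM// !mul1r !powRrM !powR_mulrn ?powR_ge0//.
  move: (powR _ _) (powR_ge0 `|X w| p) (powR _ _) (powR_ge0 `|Y w| p) => a a0 b b0.
  by have := sqr_ge0 (a - b); nra.
move=> p p0; apply: integralD_lty => //.
- by apply: measurable_funM.
- by apply: measurable_funM.
- by apply: Wspace_lty => //; rewrite mulr_gt0.
- by apply: Wspace_lty => //; rewrite mulr_gt0.
Qed.

(** From |X + Y| <= 2 max(|X|, |Y|), which treats exponents below and above 1 alike. *)
Lemma WspaceD X Y : Wspace P G X -> Wspace P G Y -> Wspace P G (fun w => X w + Y w).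
Proof.
move=> WX WY.
have mX p := measurable_powR_norm _ p (Wspace_measurable _ WX).
have mY p := measurable_powR_norm _ p (Wspace_measurable _ WY).
apply: (@WspaceI _ (fun p w => 2 `^ p * `|X w| `^ p + 2 `^ p * `|Y w| `^ p)).
- by apply: measurable_funD; exact: Wspace_meas.
- by move=> p _; apply: measurable_funD; apply: measurable_funM.
- move=> p w p0; rewrite -!powRM//.
  have XY := ler_normD (X w) (Y w).
  have mono (x y : R) : 0 <= x -> 0 <= y -> x <= y -> x `^ p <= y `^ p.
    by move=> x0 y0 xy; apply: ge0_ler_powR; rewrite ?nnegrE// ltW.
  have [h|h] := leP `|X w| `|Y w|.
    apply: (@le_trans _ _ ((2 * `|Y w|) `^ p)); last by rewrite lerDr powR_ge0.
    by apply: mono; rewrite ?mulr_ge0//; lra.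
  apply: (@le_trans _ _ ((2 * `|X w|) `^ p)); last by rewrite lerDl powR_ge0.
  by apply: mono; rewrite ?mulr_ge0//; lra.
move=> p p0; apply: integralD_lty => //.
- by apply: measurable_funM.
- by apply: measurable_funM.
- by apply: Wspace_lty => //; rewrite powR_ge0.
- by apply: Wspace_lty => //; rewrite powR_ge0.
Qed.

Lemma Wspace_norm X : Wspace P G X -> Wspace P G (fun w => `|X w|).
Proof.
move=> WX; apply: (@WspaceI _ (fun p w => `|X w| `^ p)).
- by apply: measurableT_comp => //; exact: Wspace_meas.
- by move=> p _; apply: measurable_powR_norm; exact: Wspace_measurable.
- by move=> p w _; rewrite normr_id.
- exact: WX.2.
Qed.

Lemma Wspace_sum (I : eqType) (s : seq I) (f : I -> Omega -> R) :
  (forall i, i \in s -> Wspace P G (f i)) -> Wspace P G (fun w => \sum_(i <- s) f i w).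
Proof.
elim: s => [|i s IH] h.
  by under eq_fun do rewrite big_nil; exact: Wspace_cst.
under eq_fun do rewrite big_cons; apply: WspaceD; first by apply: h; rewrite mem_head.
by apply: IH => j js; apply: h; rewrite in_cons js orbT.
Qed.

Lemma Wspace_prod (I : eqType) (s : seq I) (f : I -> Omega -> R) :
  (forall i, i \in s -> Wspace P G (f i)) -> Wspace P G (fun w => \prod_(i <- s) f i w).
Proof.
elim: s => [|i s IH] h.
  by under eq_fun do rewrite big_nil; exact: Wspace_cst.
under eq_fun do rewrite big_cons; apply: WspaceM; first by apply: h; rewrite mem_head.
by apply: IH => j js; apply: h; rewrite in_cons js orbT.
Qed.

Lemma Wspace_integrable X : Wspace P G X -> P.-integrable setT (EFin \o X).
Proof.
move=> WX; apply/integrableP; split; first exact/measurable_EFinP/Wspace_measurable.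
have := WX.2 1 ltr01; apply: le_lt_trans; rewrite le_eqVlt; apply/orP; left; apply/eqP.
by apply: eq_integral => w _ /=; rewrite powRr1.
Qed.

End Moments.

(** * Expectations of extended variables with an integrable upper bound *)

Section Expectation.
Context {R : realType} {d0 : measure_display} {Omega : measurableType d0}.
Variable P : probability Omega R.

(** For X below an integrable Z, the expectation of X is that of Z minus the integral of this
    non-negative variable, which is infinite exactly when the expectation is -oo. *)
Definition shortfall (Z : Omega -> R) (X : Omega -> \bar R) (w : Omega) : \bar R :=
  maxe 0%E ((Z w)%:E - X w)%E.

Lemma shortfall_ge0 Z X w : (0 <= shortfall Z X w)%E.
Proof. by rewrite /shortfall le_max lexx. Qed.

Lemma measurable_shortfall Z X : measurable_fun setT Z -> measurable_fun setT X ->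
  measurable_fun setT (shortfall Z X).
Proof.
move=> mZ mX; apply: measurable_maxe; first exact: measurable_cst.
by apply: emeasurable_funB => //; exact/measurable_EFinP.
Qed.

Section fixed_bound.
Variable Z : Omega -> R.
Hypotheses (Z0 : forall w, 0 <= Z w) (iZ : P.-integrable setT (EFin \o Z)).

Let mZ : measurable_fun setT Z.
Proof. by have /integrableP[/measurable_EFinP] := iZ. Qed.

Let fZ : (\int[P]_w (Z w)%:E)%E \is a fin_num.
Proof. by apply: integrable_fin_num. Qed.

(** Integrate the identity (Z - X) + X^+ = Z + X^-, in which no infinite term is subtracted after X
    = -oo is treated apart. The positive part is integrable, so the branch of [Eexp] for two
    infinite parts is never taken. *)
Lemma Eexp_shortfall X : measurable_fun setT X -> {ae P, forall w, (X w <= (Z w)%:E)%E} ->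
  Eexp P X = (\int[P]_w (Z w)%:E - \int[P]_w shortfall Z X w)%E.
Proof.
move=> mX XZ.
have mp := measurable_funepos mX; have mn := measurable_funeneg mX.
have ms := measurable_shortfall _ _ mZ mX.
have mZE : measurable_fun setT (EFin \o Z) by exact/measurable_EFinP.
have e : (\int[P]_w shortfall Z X w + \int[P]_w funepos X w =
          \int[P]_w (Z w)%:E + \int[P]_w funeneg X w)%E.
  rewrite -ge0_integralD//; last by move=> w _; exact: shortfall_ge0.
  rewrite -ge0_integralD//; last by move=> w _; rewrite lee_fin.
  apply: ge0_ae_eq_integral => //.
  - exact: emeasurable_funD.
  - exact: emeasurable_funD.
  - by move=> w _; rewrite adde_ge0 ?shortfall_ge0.
  - by move=> w _; rewrite adde_ge0// lee_fin.
  apply: ae_imply XZ => w + _; rewrite /shortfall funeposE funenegE.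
  case: (X w) => [x| |]//=; last first.
    by rewrite /maxe/= ?lteNye ?ltNyr ?ltNye ?lt0y ?addye.
  rewrite lee_fin => xZ; rewrite -!EFin_max -!EFinD; congr EFin.
  rewrite (@max_r _ _ 0 (Z w - x)) ?subr_ge0//.
  have [x0|x0] := leP x 0.
    by rewrite (@max_l _ _ (- x) 0) ?oppr_ge0// addr0.
  by rewrite (@max_r _ _ (- x) 0) ?oppr_le0 ?ltW// addr0 subrK.
have afin : (\int[P]_w funepos X w)%E \is a fin_num.
  rewrite ge0_fin_numE; last by apply: integral_ge0.
  apply: (@le_lt_trans _ _ (\int[P]_w (Z w)%:E)%E); last by rewrite ltey_eq fZ.
  apply: ae_ge0_le_integral => //; first by move=> w _; rewrite lee_fin.
  by apply: ae_imply XZ => w h _; rewrite funeposE ge_max h lee_fin Z0.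
rewrite /Eexp; have -> : (\int[P]_w funepos X w == +oo)%E = false.
  by apply/negbTE; rewrite -ltey ltey_eq afin.
move: e afin fZ.
move: (\int[P]_w funepos X w)%E (\int[P]_w (Z w)%:E)%E => [a| |]// [z| |]// e _ _ /=.
have h0 : (0 <= \int[P]_w shortfall Z X w)%E by apply: integral_ge0 => w _; exact: shortfall_ge0.
have b0 : (0 <= \int[P]_w funeneg X w)%E by apply: integral_ge0.
move: e h0 b0; move: (\int[P]_w shortfall Z X w)%E (\int[P]_w funeneg X w)%E.
move=> [h| |]// [b| |]//= [] e _ _; congr EFin; lra.
Qed.

Lemma Eexp_le X : measurable_fun setT X -> {ae P, forall w, (X w <= (Z w)%:E)%E} ->
  (Eexp P X <= \int[P]_w (Z w)%:E)%E.
Proof.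
move=> mX XZ; rewrite Eexp_shortfall//.
have : (0 <= \int[P]_w shortfall Z X w)%E by apply: integral_ge0 => w _; exact: shortfall_ge0.
move: fZ; move: (\int[P]_w (Z w)%:E)%E (\int[P]_w shortfall Z X w)%E.
by move=> [z| |]// [h| |]//= _; rewrite ?lee_fin ?leNye// => h0; lra.
Qed.

Lemma Eexp_geE X (c : R) : measurable_fun setT X -> {ae P, forall w, (X w <= (Z w)%:E)%E} ->
  (c%:E <= Eexp P X)%E = (\int[P]_w shortfall Z X w <= \int[P]_w (Z w)%:E - c%:E)%E.
Proof.
move=> mX XZ; rewrite Eexp_shortfall//.
have : (0 <= \int[P]_w shortfall Z X w)%E by apply: integral_ge0 => w _; exact: shortfall_ge0.
move: fZ; move: (\int[P]_w (Z w)%:E)%E (\int[P]_w shortfall Z X w)%E.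
move=> [z| |]// [h| |]//= _ _; rewrite ?lee_fin.
by apply/idP/idP; lra.
Qed.

(** The shortfall is a convex function of X. Stating the result for superlevel sets reduces it to
    inequalities between integrals of non-negative variables. *)
Lemma Eexp_concave X1 X2 X (c : R) :
  measurable_fun setT X1 -> measurable_fun setT X2 -> measurable_fun setT X ->
  {ae P, forall w, (X1 w <= (Z w)%:E)%E} -> {ae P, forall w, (X2 w <= (Z w)%:E)%E} ->
  {ae P, forall w, (X w <= (Z w)%:E)%E} ->
  {ae P, forall w, ((2^-1)%:E * X1 w + (2^-1)%:E * X2 w <= X w)%E} ->
  (c%:E <= Eexp P X1)%E -> (c%:E <= Eexp P X2)%E -> (c%:E <= Eexp P X)%E.
Proof.
move=> mX1 mX2 mX Z1 Z2 ZX cX; rewrite !Eexp_geE// => h1 h2.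
have s1 := measurable_shortfall _ _ mZ mX1.
have s2 := measurable_shortfall _ _ mZ mX2.
have half0 : 0 <= 2^-1 :> R by lra.
apply: (@le_trans _ _ (\int[P]_w ((2^-1)%:E * shortfall Z X1 w + (2^-1)%:E * shortfall Z X2 w))%E).
  apply: ae_ge0_le_integral => //.
  - by move=> w _; exact: shortfall_ge0.
  - exact: measurable_shortfall.
  - by move=> w _; rewrite adde_ge0// mule_ge0// ?shortfall_ge0// lee_fin.
  - by apply: emeasurable_funD; apply: emeasurable_funM => //; exact: measurable_cst.
  have Z12 := ae_imply2 _ _ _ _ (fun w => @conj _ _) Z1 Z2.
  have ZX' := ae_imply2 _ _ _ _ (fun w => @conj _ _) ZX cX.
  apply: ae_imply2 Z12 ZX' => w [a1 a2] [a cc] _; move: a1 a2 a cc.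
  (* A value -oo of X1 or X2 makes the right-hand side infinite, so only real values remain to be
     compared. *)
  have hy : ((2^-1)%:E * maxe 0 ((Z w)%:E - -oo) = +oo)%E.
    by rewrite /= maxey gt0_muley// lte_fin invr_gt0.
  have hn (x : \bar R) : ((2^-1)%:E * maxe 0 x != -oo)%E.
    by rewrite -ltNye (lt_le_trans ltNy0)// mule_ge0 ?lee_fin// le_max lexx.
  rewrite /shortfall; case: (X1 w) => [x1| |]//; last by rewrite hy addye// leey.
  case: (X2 w) => [x2| |]//; last by rewrite hy addey// leey.
  case: (X w) => [x| |] a1 a2 a cc; first last.
  - by move: cc; rewrite -!EFinM -EFinD leeNy_eq.
  - by move: a; rewrite leye_eq.
  move: a1 a2 a; rewrite !lee_fin => a1 a2 a.
  rewrite -?EFinB -!EFin_max -!EFinM -!EFinD lee_fin.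
  rewrite (@max_r _ _ 0 (Z w - x1)) ?subr_ge0// (@max_r _ _ 0 (Z w - x2)) ?subr_ge0//.
  by rewrite (@max_r _ _ 0 (Z w - x)) ?subr_ge0//; move: cc; rewrite -!EFinM -EFinD lee_fin; lra.
rewrite ge0_integralD//; last 4 first.
- by move=> w _; rewrite mule_ge0// ?shortfall_ge0// lee_fin.
- by apply: emeasurable_funM => //; exact: measurable_cst.
- by move=> w _; rewrite mule_ge0// ?shortfall_ge0// lee_fin.
- by apply: emeasurable_funM => //; exact: measurable_cst.
rewrite !ge0_integralZl_EFin//; last 2 first.
- by move=> w _; exact: shortfall_ge0.
- by move=> w _; exact: shortfall_ge0.
move: h1 h2 fZ; move: (\int[P]_w (Z w)%:E)%E => [z| |]//.
have g1 : (0 <= \int[P]_w shortfall Z X1 w)%E by apply: integral_ge0 => w _; exact: shortfall_ge0.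
have g2 : (0 <= \int[P]_w shortfall Z X2 w)%E by apply: integral_ge0 => w _; exact: shortfall_ge0.
move: g1 g2; move: (\int[P]_w shortfall Z X1 w)%E (\int[P]_w shortfall Z X2 w)%E.
move=> [x1| |]// [x2| |]// _ _ h1 h2 _; rewrite -EFinB in h1 h2 *.
by rewrite -!EFinM -EFinD lee_fin; move: h1 h2; rewrite !lee_fin; lra.
Qed.

(** A reversed Fatou lemma. Upper semicontinuity along the sequence is expressed by levels a, which
    covers limits equal to -oo. *)
Lemma Eexp_limit (Xk : nat -> Omega -> \bar R) X (c : R) :
  (forall k, measurable_fun setT (Xk k)) -> measurable_fun setT X ->
  (forall k, {ae P, forall w, (Xk k w <= (Z w)%:E)%E}) ->
  {ae P, forall w, (X w <= (Z w)%:E)%E} ->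
  {ae P, forall w, forall a : R, (X w < a%:E)%E -> \forall k \near \oo, (Xk k w < a%:E)%E} ->
  (\forall k \near \oo, (c%:E <= Eexp P (Xk k))%E) -> (c%:E <= Eexp P X)%E.
Proof.
move=> mXk mX Zk ZX usc ck; rewrite Eexp_geE//.
have msk k := measurable_shortfall _ _ mZ (mXk k).
have inf_ge (u : nat -> \bar R) (x : \bar R) :
    (\forall k \near \oo, (x <= u k)%E) -> (x <= limn_einf u)%E.
  move=> [N _ h]; rewrite limn_einf_lim.
  have cv : cvgn (einfs u) by exact: is_cvg_einfs.
  apply: lime_ge => //; exists N => // m /= Nm.
  apply: le_ereal_inf_tmp => _ [k /= mk <-]; apply: h => /=; exact: leq_trans mk.
apply: (@le_trans _ _ (\int[P]_w limn_einf (fun k => shortfall Z (Xk k) w))%E).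
  apply: ae_ge0_le_integral => //.
  - by move=> w _; exact: shortfall_ge0.
  - exact: measurable_shortfall.
  - move=> w _; apply: inf_ge; apply: nearW => k; exact: shortfall_ge0.
  - rewrite (_ : (fun w => _) = (fun w => limn (einfs (fun k => shortfall Z (Xk k) w)))); last first.
      by apply/funext => w; rewrite limn_einf_lim.
    rewrite /limn_einf; apply: (@emeasurable_fun_cvg _ _ _ _
      (fun m w => einfs (fun k => shortfall Z (Xk k) w) m)) => [m|w _].
      exact: (@measurable_fun_einfs _ _ _ setT (fun k w => shortfall Z (Xk k) w)).
    exact: is_cvg_einfs.
  apply: ae_imply usc => w h _.
  rewrite {1}/shortfall ge_max; apply/andP; split.
    by apply: inf_ge; apply: nearW => k; exact: shortfall_ge0.
  have key (r : R) : (r%:E < (Z w)%:E - X w)%E -> (r%:E <= limn_einf (fun k => shortfall Z (Xk k) w))%E.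
    move=> rx; have : (X w < (Z w - r)%:E)%E.
      move: rx; case: (X w) => [x| |]//=; last by rewrite ltNyr.
      by rewrite -EFinB !lte_fin; lra.
    move=> /h hk; apply: inf_ge; apply: filterS hk => k.
    rewrite /shortfall le_max => hk; apply/orP; right.
    move: hk; case: (Xk k w) => [x| |]//=; last by rewrite leey.
    by rewrite -EFinB lee_fin lte_fin; lra.
  (* Otherwise a real number lies strictly between the lower limit and Z - X, against [key]: the
     midpoint, l + 1, Z - X - 1 or 0, according to which of the two is finite. *)
  rewrite leNgt; apply/negP.
  move: key; move: (limn_einf _) => [l| |]; case: (X w) => [x| |]//= key.
  - rewrite -EFinB lte_fin => lx; have := key ((l + (Z w - x)) / 2).
    by rewrite -EFinB lte_fin lee_fin => hh; have : (l + (Z w - x)) / 2 <= l by [apply: hh; lra]; lra.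
  - by move=> _; have := key (l + 1); rewrite ltry lee_fin => /(_ isT); lra.
  - move=> _; have := key (Z w - x - 1); rewrite -EFinB lte_fin leeNy_eq => hh.
    by have : false by [apply: hh; lra].
  - by move=> _; have := key 0; rewrite ltry leeNy_eq => /(_ isT).
apply: (@le_trans _ _ (limn_einf (fun k => \int[P]_w shortfall Z (Xk k) w)))%E.
  by apply: (fatou P measurableT) => // k w _; exact: shortfall_ge0.
apply: le_trans (limn_einf_sup _) _; rewrite limn_esup_lim.
apply: lime_le; first exact: is_cvg_esups.
case: ck => N _ h; exists N => // m /= Nm; apply: ge_ereal_sup => _ [k /= mk <-].
by rewrite -Eexp_geE//; apply: h => /=; exact: leq_trans mk.
Qed.

End fixed_bound.
End Expectation.

(** * Almost sure convergence of strategies of nearly minimal energy *)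

Section L2Minimisers.
Context {R : realType} {d0 : measure_display} {Omega : measurableType d0}.
Variables (P : probability Omega R) (n T : nat).
Local Notation strategy := (nat -> Omega -> vec R n).
Implicit Types phi psi : strategy.

(** The second weight is written 1 - 1/2 to match the form of the concavity assumption at l =
    1/2. *)
Definition mid_strategy phi psi : strategy :=
  fun t w i => 2^-1 * phi t w i + (1 - 2^-1) * psi t w i.

Definition sq_sum phi (w : Omega) : R := \sum_(1 <= t < T.+1) dotp (phi t w) (phi t w).

Definition smeas phi := forall t, (1 <= t <= T)%N ->
  forall i, measurable_fun setT (fun w => phi t w i).

Lemma sq_sum_ge0 phi w : 0 <= sq_sum phi w.
Proof. by apply: sumr_ge0 => t _; exact: dotp_ge0. Qed.

Lemma measurable_sq_sum phi : smeas phi -> measurable_fun setT (sq_sum phi).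
Proof.
move=> mphi; rewrite (_ : sq_sum phi = fun w => \sum_(t <- index_iota 1 T.+1)
  (if (1 <= t <= T)%N then dotp (phi t w) (phi t w) else 0)); last first.
  apply/funext => w; rewrite /sq_sum big_nat_cond [RHS]big_nat_cond; apply: eq_bigr => t.
  by rewrite andbT ltnS => ->.
apply: measurable_sum => t; case: (boolP (1 <= t <= T)%N) => [tT|_]; last exact: measurable_cst.
by apply: measurable_dotp; exact: mphi.
Qed.

Lemma smeas_mid phi psi : smeas phi -> smeas psi -> smeas (mid_strategy phi psi).
Proof.
by move=> m1 m2 t tT i; apply: measurable_funD; apply: measurable_funM => //; [exact: m1|exact: m2].
Qed.

Definition energy phi : \bar R := (\int[P]_w (sq_sum phi w)%:E)%E.

Lemma energy_ge0 phi : (0 <= energy phi)%E.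
Proof. by apply: integral_ge0 => w _; rewrite lee_fin sq_sum_ge0. Qed.

Definition diff_strategy phi psi : strategy := fun t w => vsub (phi t w) (psi t w).

Lemma smeas_diff phi psi : smeas phi -> smeas psi -> smeas (diff_strategy phi psi).
Proof. by move=> m1 m2 t tT i; apply: measurable_funB; [exact: m1|exact: m2]. Qed.

Lemma parallelogram phi psi : smeas phi -> smeas psi ->
  (energy (diff_strategy phi psi) + 4%:E * energy (mid_strategy phi psi) =
   2%:E * energy phi + 2%:E * energy psi)%E.
Proof.
move=> m1 m2; rewrite /energy.
have E chi : smeas chi -> measurable_fun setT (fun w => (sq_sum chi w)%:E).
  by move=> mchi; exact/measurable_EFinP/measurable_sq_sum.
have p chi w : (0 <= (sq_sum chi w)%:E)%E by rewrite lee_fin sq_sum_ge0.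
have md := E _ (smeas_diff _ _ m1 m2); have mm := E _ (smeas_mid _ _ m1 m2).
have e1 := E _ m1; have e2 := E _ m2.
rewrite -!ge0_integralZl_EFin//.
rewrite -ge0_integralD//; last 2 first.
- by move=> w _; rewrite mule_ge0// lee_fin.
- by apply: emeasurable_funM => //; exact: measurable_cst.
rewrite -ge0_integralD//; last 4 first.
- by move=> w _; rewrite mule_ge0// lee_fin.
- by apply: emeasurable_funM => //; exact: measurable_cst.
- by move=> w _; rewrite mule_ge0// lee_fin.
- by apply: emeasurable_funM => //; exact: measurable_cst.
apply: eq_integral => w _; rewrite -!EFinM -!EFinD; congr EFin.
rewrite /sq_sum !mulr_sumr -!big_split; apply: eq_bigr => t _ /=.
rewrite /dotp !mulr_sumr -!big_split; apply: eq_bigr => i _ /=.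
by rewrite /diff_strategy /mid_strategy /vsub; field.
Qed.

Lemma coord_le_sq_sum phi t w i : (1 <= t <= T)%N -> phi t w i ^+ 2 <= sq_sum phi w.
Proof.
move=> /andP[t1 tT]; rewrite /sq_sum (bigD1_seq t) ?iota_uniq//= ?mem_index_iota ?t1//.
apply: (@le_trans _ _ (dotp (phi t w) (phi t w))).
  rewrite /dotp (bigD1 i)//= -expr2 lerDl; apply: sumr_ge0 => j _.
  by rewrite -expr2 sqr_ge0.
by rewrite lerDl; apply: sumr_ge0 => s _; exact: dotp_ge0.
Qed.

(** Distances decaying geometrically make the increments summable in expectation, hence absolutely
    summable almost surely, and each coordinate is a convergent telescoping series. *)
Lemma ae_cvg_of_energy (f : nat -> strategy) : (forall k, smeas (f k)) ->
  (forall k, (energy (diff_strategy (f k.+1) (f k)) <= (8 * ((2 ^ k.+1)%:R^-1) ^+ 2)%:E)%E) ->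
  {ae P, forall w, forall t, (1 <= t <= T)%N -> forall i, cvgn (fun k => f k t w i)}.
Proof.
move=> mf hE.
suff h (ti : nat * 'I_n) : {ae P, forall w, (1 <= ti.1 <= T)%N -> cvgn (fun k => f k ti.1 w ti.2)}.
  by apply: ae_imply (ae_countable _ _ _ h) => w hw t tT i; exact: (hw (t, i)).
case: ti => t i /=; have [tT|tT] := boolP (1 <= t <= T)%N; last exact: aeW.
suff : {ae P, forall w, cvgn (fun k => f k t w i)} by apply: ae_imply.
pose g k w : R := `|f k.+1 t w i - f k t w i|.
have mg k : measurable_fun setT (fun w => (g k w)%:E).
  apply/measurable_EFinP; apply: measurableT_comp => //.
  by apply: measurable_funB; exact: mf.
(* With del = 2^-(k+1) and x the absolute increment, x <= del + x^2 / del. Integrating gives at most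
   del + 8 del^2 / del = 9 del, and these bounds sum to 9. *)
have ig k : (\int[P]_w (g k w)%:E <= (9 / (2 ^ k.+1)%:R)%:E)%E.
  set del : R := (2 ^ k.+1)%:R^-1.
  have del0 : 0 < del by rewrite invr_gt0 ltr0n expn_gt0.
  have md : measurable_fun setT (sq_sum (diff_strategy (f k.+1) (f k))).
    by apply: measurable_sq_sum; exact: smeas_diff.
  apply: (@le_trans _ _ (\int[P]_w (del%:E + del^-1%:E * (sq_sum (diff_strategy (f k.+1) (f k)) w)%:E))%E).
    apply: ge0_le_integral => //.
    - by move=> w _; rewrite lee_fin normr_ge0.
    - apply: emeasurable_funD; first exact: measurable_cst.
      apply: emeasurable_funM; first exact: measurable_cst.
      exact/measurable_EFinP.
    - move=> w _; rewrite -EFinM -EFinD lee_fin.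
      have := coord_le_sq_sum (diff_strategy (f k.+1) (f k)) t w i tT.
      rewrite {1}/diff_strategy /vsub -real_normK ?num_real// -/(g k w).
      move: (sq_sum _ _) (g k w) => s x xs.
      rewrite mulrC -lerBlDl ler_pdivlMr//; apply: le_trans xs.
      by have := sqr_ge0 (x - del); have := sqr_ge0 x; nra.
  have msq : measurable_fun setT (fun w => (sq_sum (diff_strategy (f k.+1) (f k)) w)%:E).
    exact/measurable_EFinP.
  have sq0 w : (0 <= (sq_sum (diff_strategy (f k.+1) (f k)) w)%:E)%E.
    by rewrite lee_fin sq_sum_ge0.
  rewrite ge0_integralD; last 5 first.
  - exact: measurableT.
  - by move=> w _; rewrite lee_fin ltW.
  - exact: measurable_cst.
  - by move=> w _; rewrite mule_ge0// lee_fin invr_ge0 ltW.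
  - by apply: emeasurable_funM => //; exact: measurable_cst.
  rewrite ge0_integralZl_EFin; last 4 first.
  - exact: measurableT.
  - by move=> w _; exact: sq0.
  - exact: msq.
  - by rewrite invr_ge0 ltW.
  have -> : (\int[P]_w del%:E = del%:E)%E.
    have := integral_cst P measurableT del%:E => h; apply: (etrans h).
    by rewrite -[RHS]mule1; congr (_ * _)%E; exact: probability_setT.
  have := hE k; rewrite -/del /energy => hk.
  apply: (@le_trans _ _ (del%:E + del^-1%:E * (8 * del ^+ 2)%:E)%E).
    by rewrite leeD2l// lee_wpmul2l// lee_fin invr_ge0 ltW.
  rewrite -EFinM -EFinD lee_fin expr2 mulrCA mulKf ?gt_eqF//; lra.
have isum : P.-integrable setT (fun w => (\sum_(k <oo) (g k w)%:E)%E).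
  apply/integrableP; split.
    by apply: ge0_emeasurable_sum => // k w _ _; rewrite lee_fin normr_ge0.
  apply: (@le_lt_trans _ _ (\int[P]_w (\sum_(k <oo) (g k w)%:E))%E).
    rewrite le_eqVlt; apply/orP; left; apply/eqP; apply: eq_integral => w _.
    by rewrite gee0_abs//; apply: nneseries_ge0 => k _ _; rewrite lee_fin normr_ge0.
  rewrite integral_nneseries//; last by move=> k w _; rewrite lee_fin normr_ge0.
  apply: (@le_lt_trans _ _ (\sum_(k <oo) (9 / (2 ^ k.+1)%:R)%:E)%E).
    apply: lee_nneseries => // k _ _; apply: integral_ge0 => w _.
    by rewrite lee_fin normr_ge0.
  by apply: (@le_lt_trans _ _ 9%:E); [exact: epsilon_trick0|rewrite ltry].
apply: ae_imply (integrable_ae measurableT isum) => w /(_ I) fin.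
pose u k := f k t w i.
have : cvgn (series (telescope u)).
  apply: normed_cvg; apply: nondecreasing_is_cvgn.
    by apply: nondecreasing_series => k _ /=; rewrite normr_ge0.
  exists (fine (\sum_(k <oo) (g k w)%:E)%E) => _ [m _ <-].
  rewrite -lee_fin fineK// /series/= -sumEFin.
  by apply: nneseries_lim_ge => k _ _; rewrite lee_fin normr_ge0.
move=> cv; rewrite (_ : (fun k => _) = (fun k => u 0%N + series (telescope u) k)); last first.
  by apply/funext => k; rewrite -eq_sum_telescope.
by apply: is_cvgD => //; exact: is_cvg_cst.
Qed.

(** The infima of the energy over the nested sets increase to a finite limit, which the chosen
    elements nearly attain. The sets are not assumed closed: what passes to the limit is left to be
    checked where the lemma is applied. *)
Lemma midpoint_convex_selection (C : nat -> set strategy) (B : R) :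
  (forall k phi, C k phi -> smeas phi) ->
  (forall k phi, C k phi -> (energy phi <= B%:E)%E) ->
  (forall k l, (k <= l)%N -> C l `<=` C k) ->
  (forall k, C k !=set0) ->
  (forall k phi psi, C k phi -> C k psi -> C k (mid_strategy phi psi)) ->
  exists f : nat -> strategy, (forall k, C k (f k)) /\
    {ae P, forall w, forall t, (1 <= t <= T)%N -> forall i, cvgn (fun k => f k t w i)}.
Proof.
move=> mC bC dC neC midC.
pose e phi := fine (energy phi).
have eE k phi : C k phi -> energy phi = (e phi)%:E.
  move=> Cphi; rewrite fineK// ge0_fin_numE ?energy_ge0//.
  by rewrite (le_lt_trans (bC _ _ Cphi)) ?ltry.
have e0 phi : 0 <= e phi by rewrite fine_ge0 ?energy_ge0.
pose q k := inf [set e phi | phi in C k].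
have lbq k : has_lbound [set e phi | phi in C k] by exists 0 => _ [phi _ <-].
have qle k phi : C k phi -> q k <= e phi by move=> Cphi; apply: ge_inf => //; exists phi.
have qmono k l : (k <= l)%N -> q k <= q l.
  move=> kl; apply: lb_le_inf; first by have [phi ?] := neC l; exists (e phi), phi.
  by move=> _ [phi /(dC _ _ kl) ? <-]; exact: qle.
have qB k : q k <= B.
  have [phi Cphi] := neC k; apply: (le_trans (qle _ _ Cphi)).
  by rewrite -lee_fin -(eE _ _ Cphi); exact: bC Cphi.
pose qq := sup (range q).
have ubq : has_ubound (range q) by exists B => _ [k _ <-].
have qqq k : q k <= qq by apply: ub_le_sup => //; exists k.
pose eps k : R := ((2 ^ k.+1)%:R^-1) ^+ 2.
have eps0 k : 0 < eps k by rewrite exprn_gt0// invr_gt0 ltr0n expn_gt0.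
have epsS k : eps k.+1 <= eps k.
  rewrite ler_sqr ?nnegrE ?invr_ge0// lef_pV2 ?posrE ?ltr0n ?expn_gt0// ler_nat.
  by rewrite leq_exp2l.
(* A level N beyond k is taken so deep that its infimum is within [eps k] of the limit qq. Since N
   >= k the chosen element still belongs to [C k]. *)
have /choice[fN hfN] : forall k, exists x : strategy * nat,
    [/\ (k <= x.2)%N, C x.2 x.1, qq - eps k <= q x.2 & e x.1 <= qq + eps k].
  move=> k; have : qq - eps k < qq by rewrite gtrBl.
  move=> /sup_gt[]; first by exists (q 0%N), 0%N.
  move=> _ [N0 _ <-] qN0; pose N := maxn k N0.
  have qN : qq - eps k <= q N by apply: le_trans (ltW qN0) (qmono _ _ (leq_maxr _ _)).
  have : q N < q N + eps k by rewrite ltrDl.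
  move=> /inf_lt[]; first by have [phi ?] := neC N; exists (e phi), phi.
  move=> _ [phi Cphi <-] ephi; exists (phi, N); split => //=; first exact: leq_maxl.
  by apply: (le_trans (ltW ephi)); rewrite lerD2r.
pose f k := (fN k).1; pose N k := (fN k).2.
have Cf k : C k (f k) by have [h1 h2 _ _] := hfN k; exact: dC h2.
exists f; split => //.
apply: ae_cvg_of_energy => [k|k]; first exact: mC (Cf k).
have [a1 a2 a3 a4] := hfN k; have [b1 b2 b3 b4] := hfN k.+1.
rewrite -/(f k) -/(N k) -/(f k.+1) -/(N k.+1) in a1 a2 a3 a4 b1 b2 b3 b4.
(* The levels need not increase with k. By nesting, both elements lie in the set of the smaller
   level, whose infimum is still at least qq - eps k. *)
pose M := minn (N k.+1) (N k).
have CM : C M (mid_strategy (f k.+1) (f k)).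
  by apply: midC; [apply: dC b2; exact: geq_minl|apply: dC a2; exact: geq_minr].
have qM : qq - eps k <= q M.
  rewrite /M /minn; case: ifP => _ //.
  by apply: le_trans b3; rewrite lerD2l lerN2 epsS.
have := parallelogram _ _ (mC _ _ (Cf k.+1)) (mC _ _ (Cf k)).
rewrite (eE _ _ (Cf k.+1)) (eE _ _ (Cf k)) (eE _ _ CM).
have := energy_ge0 (diff_strategy (f k.+1) (f k)).
case: (energy _) => [x| |]// _; rewrite -!EFinM -!EFinD => -[xE].
(* Both energies are at most qq + eps k and that of the midpoint is at least qq - eps k, so the
   distance is at most 4 (qq + eps k) - 4 (qq - eps k) = 8 eps k. *)
rewrite lee_fin -/(eps k); have := qle _ _ CM; have := epsS k; lra.
Qed.

End L2Minimisers.

(** * Existence of an optimal strategy *)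

Section Utility.
Context {R : realType}.
Variable U : R -> \bar R.
Hypotheses (hU : utility_assumption U) (hp : positive_wealth_U U).

(** Upper semicontinuity says that the sets where U < a are open. *)
Lemma utility_measurable : measurable_fun setT U.
Proof.
apply: (measurability _ (ErealGenInftyO.measurableE R)) => /= _ [_ [a ->] <-].
rewrite setTI; apply: open_measurable; rewrite openE => x /=.
rewrite in_itv/= => Uxa; have [_ [_ [_ usc]]] := hU.
by move: (usc x a Uxa); apply: filterS => y Uy /=; rewrite in_itv.
Qed.

Lemma utility_fin x : 0 < x -> U x \is a fin_num.
Proof.
move=> x0; rewrite fin_numE; have [-> _] := hU; rewrite andbT.
by have : [set x | 0 < x] x by []; rewrite -hp => /interior_subset.
Qed.

(** Beyond 2, concavity keeps U under the chord through 1 and 2, two points where U is finite; up to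
    2, monotonicity bounds it by U 2. *)
Lemma utility_growth : exists2 c, 0 <= c & forall x : R, 0 <= x -> (U x <= (c * (1 + x))%:E)%E.
Proof.
have [_ [mono [conc _]]] := hU.
have f1 : U 1 \is a fin_num by exact: utility_fin.
have f2 : U 2 \is a fin_num by exact: utility_fin.
exists (`|fine (U 1)| + `|fine (U 2)|) => [|x x0]; first by rewrite addr_ge0.
set u1 := fine (U 1); set u2 := fine (U 2).
have U1 : U 1 = u1%:E by rewrite fineK.
have U2 : U 2 = u2%:E by rewrite fineK.
have a1 := ler_norm u1; have a2 := ler_norm u2.
have a1' : - u1 <= `|u1| by rewrite -normrN ler_norm.
have b1 := normr_ge0 u1; have b2 := normr_ge0 u2.
have [x2|x2] := leP x 2.
  apply: (le_trans (mono _ _ x2)); rewrite U2 lee_fin; nra.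
have fx : U x \is a fin_num by apply: utility_fin; lra.
have Ux : U x = (fine (U x))%:E by rewrite fineK.
have x1 : 0 < x - 1 by lra.
have l01 : 0 < (x - 2) / (x - 1) < 1.
  by rewrite divr_gt0 ?ltr_pdivrMr//=; lra.
have := conc 1 x _ l01.
have -> : (x - 2) / (x - 1) * 1 + (1 - (x - 2) / (x - 1)) * x = 2.
  by field; rewrite gt_eqF.
rewrite U1 U2 Ux -!EFinM -EFinD !lee_fin.
have -> : (x - 2) / (x - 1) * u1 + (1 - (x - 2) / (x - 1)) * fine (U x) =
   ((x - 2) * u1 + fine (U x)) / (x - 1) by field; rewrite gt_eqF.
rewrite ler_pdivrMr// => h; nra.
Qed.

End Utility.

Section Limits.
Context {R : realType}.

Lemma cvg_finite_sum (I : Type) (s : seq I) (f : nat -> I -> R) (l : I -> R) :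
  (forall i, f k i @[k --> \oo] --> l i) ->
  \sum_(i <- s) f k i @[k --> \oo] --> \sum_(i <- s) l i.
Proof.
move=> fl; elim: s => [|i s IH].
  by rewrite big_nil; under eq_fun do rewrite big_nil; exact: cvg_cst.
by rewrite big_cons; under eq_fun do rewrite big_cons; exact: cvgD.
Qed.

Lemma cvg_dotp m (f : nat -> vec R m) (l c : vec R m) :
  (forall i, f k i @[k --> \oo] --> l i) -> dotp (f k) c @[k --> \oo] --> dotp l c.
Proof. by move=> fl; apply: cvg_finite_sum => i; exact: cvgMr_tmp. Qed.

Lemma fine_limn_esup (u : nat -> R) : cvgn u ->
  u k @[k --> \oo] --> fine (limn_esup (fun k => (u k)%:E)).
Proof.
move=> /cvg_ex[/= l ul].
have ul' : (u k)%:E @[k --> \oo] --> l%:E by apply: cvg_EFin => //; exact: nearW.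
by have [_ ->] := cvg_limn_einf_sup ul'.
Qed.

End Limits.

Section Wealth.
Context {R : realType} {d0 : measure_display} {Omega : measurableType d0} {n : nat}.
Implicit Types (S phi psi : nat -> Omega -> vec R n).

Lemma cvg_wealth S x (f : nat -> nat -> Omega -> vec R n) phi w T :
  (forall t, (1 <= t <= T)%N -> forall i, f k t w i @[k --> \oo] --> phi t w i) ->
  forall t, (t <= T)%N -> wealth S x (f k) t w @[k --> \oo] --> wealth S x phi t w.
Proof.
move=> fphi; elim=> [|t IH] tT.
  by rewrite wealth0; under eq_fun do rewrite wealth0; exact: cvg_cst.
rewrite wealthS; under eq_fun do rewrite wealthS.
by apply: cvgD; [exact: IH (ltnW tT)|apply: cvg_dotp => i; exact: fphi].
Qed.

Lemma wealth_mid S x phi psi t w : wealth S x (mid_strategy n phi psi) t w =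
  2^-1 * wealth S x phi t w + (1 - 2^-1) * wealth S x psi t w.
Proof.
elim: t => [|t IH]; first by rewrite !wealth0; field.
rewrite !wealthS IH.
have -> : dotp (mid_strategy n phi psi t.+1 w) (dS S t.+1 w) =
  2^-1 * dotp (phi t.+1 w) (dS S t.+1 w) + (1 - 2^-1) * dotp (psi t.+1 w) (dS S t.+1 w).
  rewrite /dotp !mulr_sumr -big_split; apply: eq_bigr => i _ /=.
  by rewrite /mid_strategy; ring.
ring.
Qed.

Lemma enorm_mid phi psi t w (c : R) : enorm (phi t w) <= c -> enorm (psi t w) <= c ->
  enorm (mid_strategy n phi psi t w) <= c.
Proof.
move=> h1 h2; have c0 := le_trans (enorm_ge0 _) h1.
rewrite -ler_sqr ?nnegrE ?enorm_ge0// enorm_sqr.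
have := le_trans (ler_norm _) (dotp_le_enorm (phi t w) (psi t w)).
have e1 := enorm_sqr (phi t w); have e2 := enorm_sqr (psi t w).
have -> : dotp (mid_strategy n phi psi t w) (mid_strategy n phi psi t w) =
  4^-1 * dotp (phi t w) (phi t w) + 2^-1 * dotp (phi t w) (psi t w) +
  4^-1 * dotp (psi t w) (psi t w).
  rewrite /dotp !mulr_sumr -!big_split; apply: eq_bigr => i _ /=.
  by rewrite /mid_strategy; field.
rewrite -e1 -e2; have p1 := enorm_ge0 (phi t w); have p2 := enorm_ge0 (psi t w).
move: (enorm (phi t w)) (enorm (psi t w)) (dotp _ _) h1 h2 p1 p2 => a b z h1 h2 p1 p2 zab.
have : (a + b) ^+ 2 <= (c + c) ^+ 2 by rewrite ler_sqr ?nnegrE ?addr_ge0// lerD.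
nra.
Qed.

Lemma wealth_le S x phi (M : nat -> R) t w :
  (forall s, (1 <= s <= t)%N -> enorm (phi s w) <= M s) ->
  wealth S x phi t w <= x + \sum_(1 <= s < t.+1) M s * enorm (dS S s w).
Proof.
move=> h; rewrite /wealth lerD2l big_nat_cond [leRHS]big_nat_cond.
apply: ler_sum => s; rewrite andbT ltnS => st.
apply: le_trans (ler_norm _) _; apply: le_trans (dotp_le_enorm _ _) _.
by rewrite ler_wpM2r ?enorm_ge0// h.
Qed.

End Wealth.

Section ExpectationExtra.
Context {R : realType} {d0 : measure_display} {Omega : measurableType d0}.
Variable P : probability Omega R.

Lemma Eexp_ae_eq (X Y : Omega -> \bar R) : measurable_fun setT X -> measurable_fun setT Y ->
  {ae P, forall w, X w = Y w} -> Eexp P X = Eexp P Y.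
Proof.
move=> mX mY XY; rewrite /Eexp.
have -> : (\int[P]_w funepos X w = \int[P]_w funepos Y w)%E.
  apply: ge0_ae_eq_integral => //; [exact: measurable_funepos|exact: measurable_funepos|].
  by apply: ae_imply XY => w h _; rewrite !funeposE h.
have -> // : (\int[P]_w funeneg X w = \int[P]_w funeneg Y w)%E.
apply: ge0_ae_eq_integral => //; [exact: measurable_funeneg|exact: measurable_funeneg|].
by apply: ae_imply XY => w h _; rewrite !funenegE h.
Qed.

Lemma Eexp_cst (r : R) : Eexp P (fun _ => r%:E) = r%:E.
Proof.
have ic (z : \bar R) : (\int[P]_w (fun _ : Omega => z) w = z)%E.
  have h := integral_cst P measurableT z; apply: (etrans h).
  by rewrite -[RHS]mule1; congr (_ * _)%E; exact: probability_setT.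
rewrite /Eexp (eq_integral (fun _ => maxe r%:E 0)%E); last by move=> w _; rewrite funeposE.
rewrite ic (eq_integral (fun _ => maxe (- r%:E) 0)%E); last by move=> w _; rewrite funenegE.
rewrite ic -!EFin_max /= -EFinB; congr EFin.
have [r0|r0] := leP r 0; first by rewrite max_l ?oppr_ge0// sub0r opprK.
by rewrite max_r ?oppr_le0 ?ltW// subr0.
Qed.

End ExpectationExtra.

(** * Maximising the robust utility over dominated strategies *)

Section Optimizer.
Context {R : realType} {d0 : measure_display} {Omega : measurableType d0}.
Context {P : probability Omega R} {n T : nat} {F : nat -> set (set Omega)}.
Variables (Sfam : set (nat -> Omega -> vec R n)) (U : R -> \bar R) (w0 : R).
Variable M : nat -> Omega -> R.
Hypothesis hF : is_filtration P T F.
Hypothesis adS : forall S, Sfam S -> adapted T F S.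
Hypothesis neS : Sfam !=set0.
Hypothesis hU : utility_assumption U.
Hypothesis hp : positive_wealth_U U.
Hypothesis w0_gt0 : 0 < w0.
Hypothesis WM : forall t, (1 <= t <= T)%N -> Wspace P (F T) (M t).
Hypothesis WdS : forall S, Sfam S -> forall t, (1 <= t <= T)%N ->
  Wspace P (F T) (fun w => enorm (dS S t w)).
Hypothesis domM : forall phi, admissible P T F Sfam w0 phi ->
  exists phi', [/\ admissible P T F Sfam w0 phi',
    (forall S, Sfam S -> {ae P, forall w, wealth S w0 phi' T w = wealth S w0 phi T w}) &
    (forall t, (1 <= t <= T)%N -> {ae P, forall w, enorm (phi' t w) <= M t w})].

Local Notation strategy := (nat -> Omega -> vec R n).
Implicit Types phi psi : strategy.
Local Notation adm := (admissible P T F Sfam w0).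
Local Notation robust := (robust_util P T Sfam U w0).
Local Notation UW S phi := (fun w => U (wealth S w0 phi T w)).

Definition bounded_adm : set strategy := [set phi | adm phi /\
  forall t, (1 <= t <= T)%N -> {ae P, forall w, enorm (phi t w) <= M t w}].

Let sF := filtration_sigma hF T (leqnn T).
Let FF := filtration_sub hF T (leqnn T).

Lemma measurable_utility_wealth S phi : Sfam S -> predictable T F phi ->
  measurable_fun setT (UW S phi).
Proof.
move=> SF pphi; apply: (measurableT_comp (utility_measurable _ hU)).
exact: measurable_wealth hF _ _ _ _ (adS _ SF) pphi (leqnn T).
Qed.

(** The bound may depend on the model but not on the strategy: within a fixed model it is what
    allows Fatou along a sequence of strategies. *)
Lemma utility_bound : exists Z : strategy -> Omega -> R,
  forall S, Sfam S -> [/\ forall w, 0 <= Z S w, P.-integrable setT (EFin \o Z S) &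
    forall phi, bounded_adm phi -> {ae P, forall w, (U (wealth S w0 phi T w) <= (Z S w)%:E)%E}].
Proof.
have [c c0 Uc] := utility_growth _ hU hp.
(* Absolute values of M are taken because M is not assumed non-negative, while the bound is required
   to be non-negative everywhere. *)
exists (fun S w => c * (1 + (w0 + \sum_(s <- index_iota 1 T.+1) `|M s w| * enorm (dS S s w)))).
move=> S SF; split.
- move=> w; apply: mulr_ge0 => //; apply: addr_ge0 => //; apply: addr_ge0; first exact: ltW.
  by apply: sumr_ge0 => s _; rewrite mulr_ge0 ?enorm_ge0.
- apply: (Wspace_integrable _ _ sF FF); apply: (WspaceM _ _ sF FF); first exact: Wspace_cst.
  apply: (WspaceD _ _ sF FF); first exact: Wspace_cst.
  apply: (WspaceD _ _ sF FF); first exact: Wspace_cst.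
  apply: (Wspace_sum _ _ sF FF) => s; rewrite mem_index_iota ltnS => sT.
  apply: (WspaceM _ _ sF FF); last exact: WdS.
  by apply: (Wspace_norm _ _ sF FF); exact: WM.
- move=> phi [[pphi aphi] bphi].
  have hb : {ae P, forall w, forall s, (1 <= s <= T)%N -> enorm (phi s w) <= `|M s w|}.
    apply: ae_countable => s; have [sT|sT] := boolP (1 <= s <= T)%N; last exact: aeW.
    by apply: ae_imply (bphi s sT) => w h _; exact: le_trans (ler_norm _).
  apply: ae_imply2 hb (aphi S SF T (leqnn T)) => w hw W0.
  apply: (le_trans (Uc _ W0)); rewrite lee_fin ler_wpM2l// lerD2l.
  exact: (wealth_le _ _ _ (fun s => `|M s w|)).
Qed.

Lemma robust_ge phi (c : \bar R) : (c <= robust phi)%E <->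
  forall S, Sfam S -> (c <= Eexp P (UW S phi))%E.
Proof.
split=> [h S SF|h].
  by apply: (le_trans h); apply: ereal_inf_lbound; exists S.
by apply: le_ereal_inf_tmp => _ [S SF <-]; exact: h.
Qed.

Lemma predictable_mid phi psi : predictable T F phi -> predictable T F psi ->
  predictable T F (mid_strategy n phi psi).
Proof.
move=> p1 p2 t tT; have t1T : (t.-1 <= T)%N.
  by case/andP: tT => _ ?; rewrite (leq_trans (leq_pred _)).
have sG := filtration_sigma hF _ t1T.
apply/Gmeas_vecE => // i; apply: measurable_funD; apply: measurable_funM => //.
  by have /(Gmeas_vecE _ sG) := p1 t tT.
by have /(Gmeas_vecE _ sG) := p2 t tT.
Qed.

Lemma bounded_adm_mid phi psi : bounded_adm phi -> bounded_adm psi ->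
  bounded_adm (mid_strategy n phi psi).
Proof.
move=> [[p1 a1] b1] [[p2 a2] b2]; split; first split.
- exact: predictable_mid.
- move=> S SF t tT; apply: ae_imply2 (a1 _ SF _ tT) (a2 _ SF _ tT) => w h1 h2.
  rewrite wealth_mid; lra.
- move=> t tT; apply: ae_imply2 (b1 _ tT) (b2 _ tT) => w; exact: enorm_mid.
Qed.

Lemma robust_mid phi psi (c : R) : bounded_adm phi -> bounded_adm psi ->
  (c%:E <= robust phi)%E -> (c%:E <= robust psi)%E ->
  (c%:E <= robust (mid_strategy n phi psi))%E.
Proof.
move=> b1 b2 /robust_ge h1 /robust_ge h2; apply/robust_ge => S SF.
have [Z hZ] := utility_bound; have [Z0 iZ UZ] := hZ _ SF.
have b := bounded_adm_mid _ _ b1 b2.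
have m phi' : bounded_adm phi' -> measurable_fun setT (UW S phi').
  by move=> [[p' _] _]; exact: measurable_utility_wealth.
apply: (Eexp_concave _ _ Z0 iZ (UW S phi) (UW S psi)).
- exact: m.
- exact: m.
- exact: m.
- exact: UZ.
- exact: UZ.
- exact: UZ.
- apply: aeW => w; rewrite wealth_mid; have [_ [_ [conc _]]] := hU.
  have half : 0 < (2^-1 : R) < 1 by lra.
  have := conc (wealth S w0 phi T w) (wealth S w0 psi T w) _ half.
  by rewrite (_ : 1 - 2^-1 = 2^-1 :> R)//; field.
- exact: h1.
- exact: h2.
Qed.

Lemma smeas_predictable phi : predictable T F phi -> smeas n T phi.
Proof.
move=> p t tT; have t1T : (t.-1 <= T)%N.
  by case/andP: tT => _ ?; rewrite (leq_trans (leq_pred _)).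
exact: (Gmeas_vec_measurable hF _ _ _ t1T (p t tT)).
Qed.

Lemma energy_bound : exists B : R, forall phi, bounded_adm phi ->
  (energy P n T phi <= B%:E)%E.
Proof.
pose Q w := \sum_(s <- index_iota 1 T.+1) M s w * M s w.
have WQ : Wspace P (F T) Q.
  apply: (Wspace_sum _ _ sF FF) => s; rewrite mem_index_iota ltnS => sT.
  by apply: (WspaceM _ _ sF FF); exact: WM.
have iQ := Wspace_integrable _ _ sF FF _ WQ.
exists (fine (\int[P]_w (Q w)%:E)%E) => phi [[p _] b].
rewrite fineK; last by apply: integrable_fin_num.
have hb : {ae P, forall w, forall s, (1 <= s <= T)%N -> enorm (phi s w) <= M s w}.
  apply: ae_countable => s; have [sT|sT] := boolP (1 <= s <= T)%N; last exact: aeW.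
  by apply: ae_imply (b s sT) => w h _.
apply: ae_ge0_le_integral => //.
- by move=> w _; rewrite lee_fin sq_sum_ge0.
- by apply/measurable_EFinP; apply: measurable_sq_sum; exact: smeas_predictable.
- by move=> w _; rewrite lee_fin sumr_ge0// => s _; rewrite -expr2 sqr_ge0.
- by have /integrableP[] := iQ.
apply: ae_imply hb => w h _; rewrite lee_fin /sq_sum /Q big_nat_cond [leRHS]big_nat_cond.
apply: ler_sum => s; rewrite andbT ltnS => sT; rewrite -enorm_sqr -expr2.
by rewrite ler_sqr ?nnegrE ?enorm_ge0 ?h// (le_trans (enorm_ge0 _) (h s sT)).
Qed.

Lemma zero_strategy_adm : adm (fun _ _ => @vzero R n).
Proof.
split.
  move=> t tT; have t1T : (t.-1 <= T)%N.
    by case/andP: tT => _ ?; rewrite (leq_trans (leq_pred _)).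
  by apply/Gmeas_vecE; [exact: filtration_sigma hF _ t1T|move=> i; exact: measurable_cst].
move=> S SF t tT; apply: aeW => w.
rewrite /wealth big1 ?addr0 ?ltW// => s _; by rewrite dotpC dotp0.
Qed.

(** A single model already bounds the value from above, and the zero strategy gives U w0, finite as
    w0 > 0, from below. Finiteness makes u - 1/(k+1) lie strictly below the supremum, so that the
    sets of near-optimal strategies are nonempty. *)
Lemma value_fin : exists u : R, value P T F Sfam U w0 = u%:E.
Proof.
have [S0 SF0] := neS.
have [Z hZ] := utility_bound; have [Z0 iZ UZ] := hZ _ SF0.
have ub : (value P T F Sfam U w0 <= \int[P]_w (Z S0 w)%:E)%E.
  apply: ge_ereal_sup => _ [phi aphi <-].
  have [phi' [a' e' b']] := domM _ aphi.
  apply: (@le_trans _ _ (Eexp P (UW S0 phi))).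
    by apply: ereal_inf_lbound; exists S0.
  have m phi1 : adm phi1 -> measurable_fun setT (UW S0 phi1).
    by move=> [p' _]; exact: measurable_utility_wealth.
  rewrite (Eexp_ae_eq P (UW S0 phi) (UW S0 phi') (m _ aphi) (m _ a')); last first.
    by apply: ae_imply (e' _ SF0) => w ->.
  apply: (Eexp_le _ _ Z0 iZ); first exact: m.
  exact: UZ.
have lb : (U w0 <= value P T F Sfam U w0)%E.
  apply: (@le_trans _ _ (robust (fun _ _ => @vzero R n))); last first.
    by apply: ereal_sup_ubound; exists (fun _ _ => @vzero R n) => //; exact: zero_strategy_adm.
  apply/robust_ge => S SF.
  have Uf := utility_fin _ hU hp _ w0_gt0.
  rewrite (_ : UW S _ = fun _ => (fine (U w0))%:E); first by rewrite Eexp_cst fineK.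
  apply/funext => w; rewrite fineK// /wealth big1 ?addr0// => s _; by rewrite dotpC dotp0.
have Uf := utility_fin _ hU hp _ w0_gt0.
have Zf : (\int[P]_w (Z S0 w)%:E)%E \is a fin_num by apply: integrable_fin_num.
exists (fine (value P T F Sfam U w0)); rewrite fineK// fin_real//.
apply/andP; split.
  by apply: lt_le_trans lb; rewrite ltNye_eq Uf.
by apply: (le_lt_trans ub); rewrite ltey_eq Zf.
Qed.

Lemma optimizer_exists : exists phi, adm phi /\
    value P T F Sfam U w0 = robust phi /\ (robust phi < +oo)%E.
Proof.
have [u uE] := value_fin.
have [B hB] := energy_bound.
pose c k : R := u - k.+1%:R^-1.
pose C k : set strategy := [set phi | bounded_adm phi /\ ((c k)%:E <= robust phi)%E].
have cmono k l : (k <= l)%N -> c k <= c l.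
  by move=> kl; rewrite lerD2l lerN2 lef_pV2 ?posrE// ler_nat.
have [|||||f [Cf cvf]] := @midpoint_convex_selection R d0 Omega P n T C B.
- by move=> k phi [[[p _] _] _]; exact: smeas_predictable.
- by move=> k phi [b _]; exact: hB.
- move=> k l kl phi [b h]; split => //; apply: le_trans h.
  by rewrite lee_fin cmono.
(* A near-optimal strategy is replaced by its dominated version, whose terminal wealth agrees almost
   surely in each model; the utilities are unchanged. *)
- move=> k; have : ((c k)%:E < value P T F Sfam U w0)%E.
    by rewrite uE lte_fin gtrBl.
  move=> /ereal_sup_gt[_ [phi aphi <-] h].
  have [phi' [a' e' b']] := domM _ aphi; exists phi'; split => //.
  apply/robust_ge => S SF; have /robust_ge /(_ _ SF) := ltW h.
  move=> h'; apply: (le_trans h'); rewrite le_eqVlt; apply/orP; left; apply/eqP.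
  apply: Eexp_ae_eq.
  + exact: measurable_utility_wealth SF aphi.1.
  + exact: measurable_utility_wealth SF a'.1.
  + by apply: ae_imply (e' _ SF) => w ->.
- by move=> k phi psi [b1 h1] [b2 h2]; split; [exact: bounded_adm_mid|exact: robust_mid].
(* The upper limit is defined in every scenario, which makes phi predictable without reference to
   the null set where the sequence fails to converge. *)
pose phi : strategy := fun t w i => fine (limn_esup (fun k => (f k t w i)%:E)).
have pf k : predictable T F (f k) by have [[[]]] := Cf k.
have pphi : predictable T F phi.
  move=> t tT; have t1T : (t.-1 <= T)%N.
    by case/andP: tT => _ ?; rewrite (leq_trans (leq_pred _)).
  have sG := filtration_sigma hF _ t1T.
  apply/Gmeas_vecE => // i.
  apply: (measurableT_comp (@fine_measurable R setT measurableT)).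
  apply: (@measurable_fun_limn_esup _ (g_sigma_algebraType (F t.-1)) R setT
    (fun k w => (f k t w i)%:E)) => k.
  by apply/measurable_EFinP; have /(Gmeas_vecE _ sG) := pf k t tT.
have cvphi : {ae P, forall w, forall t, (1 <= t <= T)%N -> forall i,
    f k t w i @[k --> \oo] --> phi t w i}.
  by apply: ae_imply cvf => w h t tT i; apply: fine_limn_esup; exact: h.
have cvW S t : (t <= T)%N -> {ae P, forall w,
    wealth S w0 (f k) t w @[k --> \oo] --> wealth S w0 phi t w}.
  by move=> tT; apply: ae_imply cvphi => w h; exact: cvg_wealth h _ tT.
have aphi : adm phi.
  split=> // S SF t tT.
  have : {ae P, forall w, forall k : nat, 0 <= wealth S w0 (f k) t w}.
    by apply: ae_countable => k; have [[[_ a] _] _] := Cf k; exact: a.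
  apply: ae_imply2 (cvW S t tT) => w cv h.
  by apply: cvgr_to_ge cv _; exact: nearW.
(* The bound must be carried to the limit as well, since the integrable upper bound on utilities is
   available for dominated strategies only. *)
have bphi : bounded_adm phi.
  split=> // t tT.
  have : {ae P, forall w, forall k : nat, enorm (f k t w) <= M t w}.
    by apply: ae_countable => k; have [[_ b] _] := Cf k; exact: b.
  apply: ae_imply2 cvphi => w cv h.
  have M0 : 0 <= M t w := le_trans (enorm_ge0 _) (h 0%N).
  rewrite -ler_sqr ?nnegrE ?enorm_ge0// enorm_sqr.
  have : dotp (f k t w) (f k t w) @[k --> \oo] --> dotp (phi t w) (phi t w).
    by apply: cvg_finite_sum => i; apply: cvgM; exact: cv.
  move=> /cvgr_to_le; apply; apply: nearW => k; rewrite -enorm_sqr.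
  by rewrite ler_sqr ?nnegrE ?enorm_ge0.
have ge_u : (u%:E <= robust phi)%E.
  apply/robust_ge => S SF; apply/lee_subgt0Pr => e e0.
  have [Z hZ] := utility_bound; have [Z0 iZ UZ] := hZ _ SF.
  rewrite -EFinB; apply: (Eexp_limit _ _ Z0 iZ (fun k => UW S (f k))).
  - by move=> k; exact: measurable_utility_wealth.
  - exact: measurable_utility_wealth.
  - by move=> k; apply: UZ; have [] := Cf k.
  - exact: UZ.
  (* The neighbourhood on which U stays below a eventually contains the converging terminal
     wealths. *)
  - apply: ae_imply (cvW S T (leqnn T)) => w cv a Ua.
    have [_ [_ [_ usc]]] := hU; exact: (cv _ (usc _ _ Ua)).
  - exists (Num.truncn e^-1) => // k /= ek.
    have [_ /robust_ge /(_ _ SF)] := Cf k; apply: le_trans.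
    rewrite lee_fin lerD2l lerN2 -[leRHS]invrK lef_pV2 ?posrE ?invr_gt0//.
    by apply: ltW; apply: (lt_le_trans (truncnS_gt _)); rewrite ler_nat ltnS.
have le_u : (robust phi <= u%:E)%E.
  by rewrite -uE; apply: ereal_sup_ubound; exists phi.
exists phi; split => //; split; first by rewrite uE; apply/eqP; rewrite eq_le ge_u le_u.
by apply: (le_lt_trans le_u); rewrite ltry.
Qed.

End Optimizer.

Theorem theorem3p3 (R : realType) (d0 : measure_display)
  (Omega : measurableType d0) (P : probability Omega R) (d T : nat)
  (F : nat -> set (set Omega)) (Sfam : set (nat -> Omega -> vec R d))
  (U : R -> \bar R) (w0 : R) :
  complete_P P ->
  is_filtration P T F ->
  Sfam !=set0 ->
  (forall S, Sfam S -> adapted T F S) ->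
  utility_assumption U ->
  positive_wealth_U U ->
  0 < w0 ->
  (exists (Ss : nat -> Omega -> vec R d) (beta kappa : nat -> Omega -> R),
     Sstar P T F Sfam Ss /\
     forall t, (1 <= t <= T)%N ->
       Gmeas_real (F t.-1) (beta t) /\ Gmeas_real (F t.-1) (kappa t) /\
       {ae P, forall w, 0 < beta t w} /\ {ae P, forall w, 0 < kappa t w} /\
       Wspace P (F T) (fun w => (beta t w)^-1) /\
       forall D, Dver P (F t.-1) (dS Ss t) D ->
             exists Y, is_essinf P
               [set Z | exists (xi : Omega -> vec R d) (g : Omega -> R),
                  Gmeas_vec (F t.-1) xi /\
                  {ae P, forall w, D w (xi w)} /\
                  is_condprob P (F t.-1)
                        [set w | dotp (xi w) (dS Ss t w)
                                 <= - (beta t w * enorm (xi w))] g /\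
                  Z = (fun w => (g w)%:E)] Y /\
             {ae P, forall w, D w <> [set @vzero R d] -> ((kappa t w)%:E <= Y w)%E}) ->
  (forall S, Sfam S -> forall t, (1 <= t <= T)%N ->
     Wspace P (F T) (fun w => enorm (dS S t w))) ->
  exists phi, admissible P T F Sfam w0 phi /\
    value P T F Sfam U w0 = robust_util P T Sfam U w0 phi /\
    (robust_util P T Sfam U w0 phi < +oo)%E.
Proof.
move=> _ hF neS adS hU hp w0_gt0 [Ss [beta [kappa [hSs hbk]]]] WdS.
have sF := filtration_sigma hF T (leqnn T).
have FF := filtration_sub hF T (leqnn T).
have [SsF _] := hSs.
apply: (@optimizer_exists R d0 Omega P d T F Sfam U w0 (strategy_dom w0 Ss beta)) => //.
(* The bound is a product of w0, of factors 1 + |dS_s| / beta_s for s < t, and of 1 / beta_t, each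
   of which has all moments. *)
- move=> t tT; apply: (WspaceM _ _ sF FF); last by have [_ [_ [_ [_ []]]]] := hbk t tT.
  apply: (WspaceM _ _ sF FF); first exact: Wspace_cst.
  apply: (Wspace_prod _ _ sF FF) => s; rewrite mem_index_iota => /andP[s1 st].
  have sT : (1 <= s <= T)%N.
    case/andP: tT => t1 tT; rewrite s1/=; apply: leq_trans tT.
    by rewrite -ltnS (leq_trans st)// ltnS leq_pred.
  apply: (WspaceD _ _ sF FF); first exact: Wspace_cst.
  apply: (WspaceM _ _ sF FF); first exact: WdS.
  by have [_ [_ [_ [_ []]]]] := hbk s sT.
- move=> phi; exact: (dominated_strategy _ _ _ _ _ hF adS hSs hbk).
Qed.
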